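(* Let $k\in\mathbb N_0$, $0<\alpha\le1$ and $f\in\mathcal C^{k,\alpha}(\mathbb S^2)$. Then for all $n\in\mathbb Z^2\setminus\{0\}$ the Fourier coefficients of the DFS function $\tilde f$ satisfy $$|c_n(\tilde f)|\le 2^{\frac{k+\alpha}{2}-1}\pi^\alpha\,\frac{(k+3)!}{|n|^{k+\alpha}}\,\|f\|_{\mathcal C^{k,\alpha}(\mathbb S^2)}.$$
   Context: $|n|$ denotes the Euclidean norm of $n\in\mathbb Z^2$; $\|\cdot\|$ Euclidean norm; $B^d_k:=\{\beta\in\mathbb N_0^d:\sum_i\beta_i\le k\}$. For open $U\subset\mathbb R^d$: $\mathcal C^k(U)$ the bounded uniformly continuous complex functions whose classical derivatives $D^\beta f$, $\beta\in B^d_k$, are bounded and uniformly continuous; for $0<\alpha<1$, $\mathcal C^{k,\alpha}(U)$ those with $\sup\{|D^\beta f(x)-D^\beta f(y)|/\|x-y\|^\alpha:x\ne y,|\beta|=k\}<\infty$. Sphere: for $0\le\alpha<1$, $\|f\|_{\mathcal C^{k,\alpha}(\mathbb S^2)}$ is the infimum, over all $f^*\in\mathcal C^{k,\alpha}(U)$ with $U\supset\mathbb S^2$ open and $f^*|_{\mathbb S^2}=f$ ($\mathcal C^{k,0}=\mathcal C^k$), of $\sum_{\beta\in B^3_k}\sup_{\mathbb S^2}|D^\beta f^*|$ plus (if $\alpha>0$) $\sup\{|D^\beta f^*(\xi)-D^\beta f^*(\eta)|/\|\xi-\eta\|^\alpha:\xi\ne\eta\in\mathbb S^2,|\beta|=k\}$;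 $\mathcal C^{k,\alpha}(\mathbb S^2)$ consists of $f$ with finite norm. Convention: $\mathcal C^{k,1}(\mathbb S^2):=\mathcal C^{k+1}(\mathbb S^2)$ with $\|\cdot\|_{\mathcal C^{k,1}(\mathbb S^2)}:=\|\cdot\|_{\mathcal C^{k+1}(\mathbb S^2)}$. DFS function: $\tilde f=f\circ\phi$, $\phi(\lambda,\theta)=(\cos\lambda\sin\theta,\sin\lambda\sin\theta,\cos\theta)$, on $\mathbb T^2=\mathbb R^2/(2\pi\mathbb Z^2)$; $c_n(g)=(2\pi)^{-2}\int_{\mathbb T^2}g(x)e^{-i\langle n,x\rangle}dx$. *)

(* Defs.v *)
From Stdlib Require Import Reals Lra List.
From Coquelicot Require Import Coquelicot.
Open Scope R_scope.

Record P3 := mkP3 { p1 : R; p2 : R; p3 : R }.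

Definition enorm3 (x : P3) : R := sqrt (p1 x ^ 2 + p2 x ^ 2 + p3 x ^ 2).
Definition sub3 (x y : P3) : P3 := mkP3 (p1 x - p1 y) (p2 x - p2 y) (p3 x - p3 y).

(** x + t e_i  (i = 0,1,2; directions >= 2 are treated as the third axis) *)
Definition shift3 (i : nat) (x : P3) (t : R) : P3 :=
  match i with
  | 0%nat => mkP3 (p1 x + t) (p2 x) (p3 x)
  | 1%nat => mkP3 (p1 x) (p2 x + t) (p3 x)
  | _ => mkP3 (p1 x) (p2 x) (p3 x + t)
  end.

Definition S2 (x : P3) : Prop := p1 x ^ 2 + p2 x ^ 2 + p3 x ^ 2 = 1.

Definition open3 (U : P3 -> Prop) : Prop :=
  forall x, U x -> exists r, 0 < r /\ forall y, enorm3 (sub3 y x) < r -> U y.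

Definition pd (i : nat) (g : P3 -> C) (x : P3) : C :=
  (Derive (fun t => fst (g (shift3 i x t))) 0,
   Derive (fun t => snd (g (shift3 i x t))) 0).

Definition ex_pd (i : nat) (g : P3 -> C) (x : P3) : Prop :=
  ex_derive (fun t => fst (g (shift3 i x t))) 0 /\
  ex_derive (fun t => snd (g (shift3 i x t))) 0.

Fixpoint Dl (ds : list nat) (g : P3 -> C) : P3 -> C :=
  match ds with
  | nil => g
  | d :: ds' => pd d (Dl ds' g)
  end.

Fixpoint DexistsOn (U : P3 -> Prop) (ds : list nat) (g : P3 -> C) : Prop :=
  match ds with
  | nil => True
  | d :: ds' => DexistsOn U ds' g /\ forall x, U x -> ex_pd d (Dl ds' g) x
  end.

Definition mi := (nat * nat * nat)%type.
Definition mi_abs (b : mi) : nat := let '(b1, b2, b3) := b in (b1 + b2 + b3)%nat.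
Definition mi_list (b : mi) : list nat :=
  let '(b1, b2, b3) := b in repeat 0%nat b1 ++ repeat 1%nat b2 ++ repeat 2%nat b3.

Definition Dbeta (b : mi) (g : P3 -> C) : P3 -> C := Dl (mi_list b) g.
Definition Dbeta_exists (U : P3 -> Prop) (b : mi) (g : P3 -> C) : Prop :=
  DexistsOn U (mi_list b) g.

(** Enumeration of B^3_k = { beta : |beta| <= k } *)
Definition Bk (k : nat) : list mi :=
  flat_map (fun b1 =>
    flat_map (fun b2 =>
      map (fun b3 => (b1, b2, b3)) (seq 0 (S (k - b1 - b2))))
      (seq 0 (S (k - b1))))
    (seq 0 (S k)).

Definition bounded_on (U : P3 -> Prop) (g : P3 -> C) : Prop :=
  exists M, forall x, U x -> Cmod (g x) <= M.

Definition unif_cont_on (U : P3 -> Prop) (g : P3 -> C) : Prop :=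
  forall eps, 0 < eps -> exists delta, 0 < delta /\
    forall x y, U x -> U y -> enorm3 (sub3 x y) < delta ->
      Cmod (Cminus (g x) (g y)) < eps.

Definition Ck (U : P3 -> Prop) (k : nat) (g : P3 -> C) : Prop :=
  forall b, (mi_abs b <= k)%nat ->
    Dbeta_exists U b g /\ bounded_on U (Dbeta b g) /\ unif_cont_on U (Dbeta b g).

(** C^{k,alpha}(U), 0 <= alpha < 1 (alpha = 0 gives C^k(U)) *)
Definition Cka (U : P3 -> Prop) (k : nat) (alpha : R) (g : P3 -> C) : Prop :=
  Ck U k g /\
  (0 < alpha -> exists M, forall b x y, mi_abs b = k -> U x -> U y -> x <> y ->
     Cmod (Cminus (Dbeta b g x) (Dbeta b g y)) <= M * Rpower (enorm3 (sub3 x y)) alpha).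

Definition sup_S2 (b : mi) (g : P3 -> C) : R :=
  real (Lub_Rbar (fun v => exists xi, S2 xi /\ v = Cmod (Dbeta b g xi))).

Definition holder_S2 (k : nat) (alpha : R) (g : P3 -> C) : R :=
  real (Lub_Rbar (fun v => exists b xi eta, mi_abs b = k /\ S2 xi /\ S2 eta /\ xi <> eta /\
     v = Cmod (Cminus (Dbeta b g xi) (Dbeta b g eta)) / Rpower (enorm3 (sub3 xi eta)) alpha)).

Definition ext_value (k : nat) (alpha : R) (g : P3 -> C) : R :=
  fold_right Rplus 0 (map (fun b => sup_S2 b g) (Bk k)) +
  (if Rlt_dec 0 alpha then holder_S2 k alpha g else 0).

Definition ext_values (k : nat) (alpha : R) (f : P3 -> C) (v : R) : Prop :=
  exists (U : P3 -> Prop) (g : P3 -> C),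
    open3 U /\ (forall xi, S2 xi -> U xi) /\ Cka U k alpha g /\
    (forall xi, S2 xi -> g xi = f xi) /\ v = ext_value k alpha g.

(** ||f||_{C^{k,alpha}(S^2)} for 0 <= alpha < 1, and membership (finite norm) *)
Definition normS (k : nat) (alpha : R) (f : P3 -> C) : R :=
  real (Glb_Rbar (ext_values k alpha f)).
Definition inS (k : nat) (alpha : R) (f : P3 -> C) : Prop :=
  exists v, ext_values k alpha f v.

(** Including the convention C^{k,1}(S^2) := C^{k+1}(S^2) *)
Definition normSH (k : nat) (alpha : R) (f : P3 -> C) : R :=
  if Rlt_dec alpha 1 then normS k alpha f else normS (S k) 0 f.
Definition inSH (k : nat) (alpha : R) (f : P3 -> C) : Prop :=
  if Rlt_dec alpha 1 then inS k alpha f else inS (S k) 0 f.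

Definition phi (lam th : R) : P3 := mkP3 (cos lam * sin th) (sin lam * sin th) (cos th).
Definition dfs (f : P3 -> C) (lam th : R) : C := f (phi lam th).

Definition fourier_integrand (g : R -> R -> C) (n1 n2 : Z) (x1 x2 : R) : C :=
  Cmult (g x1 x2) (cos (IZR n1 * x1 + IZR n2 * x2), - sin (IZR n1 * x1 + IZR n2 * x2)).

Definition fourier_coef (g : R -> R -> C) (n1 n2 : Z) : C :=
  let I_re := RInt (fun x1 => RInt (fun x2 => fst (fourier_integrand g n1 n2 x1 x2)) 0 (2 * PI)) 0 (2 * PI) in
  let I_im := RInt (fun x1 => RInt (fun x2 => snd (fourier_integrand g n1 n2 x1 x2)) 0 (2 * PI)) 0 (2 * PI) in
  (/ (2 * PI) ^ 2 * I_re, / (2 * PI) ^ 2 * I_im).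

Definition znorm (n1 n2 : Z) : R := sqrt (IZR n1 ^ 2 + IZR n2 ^ 2).

(* Main.v *)
(** Let [g] extend [f] to a neighbourhood of the sphere and let [n] be the entry
of larger modulus of the frequency, so that [|n| >= |(n1, n2)| / sqrt 2].  In the
corresponding variable the DFS function is [g] along a meridian or a parallel,
a curve whose coordinates are of the form [a cos (t + c) + d] with [|a| <= 1].
Differentiating [D^b g] along such a curve times a product of [j] waves gives
[3 + j] objects of the same kind with at most [j + 1] waves, so the [k]-th
derivative has at most [(k + 2)! / 2] summands, each of which changes by at most
[(k + 4) N |h|^alpha] over a step [h], with [N] the norm of [g].  Integrating by
parts [k] times, and comparing the integral with its translate by the half
period [h = PI / n] of the kernel, yields
[|c_n| <= (k + 3)! N / 2 * |PI / n|^alpha / |n|^k]; take the infimum over [g]. *)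

Require Import Defs.
From Stdlib Require Import Reals Arith ZArith Factorial Lra Lia List.
From Coquelicot Require Import Coquelicot.
Open Scope R_scope.

(** * Decay of one-dimensional Fourier integrals *)

(** The norm controls increments of order [k] by the Hölder seminorm, and lower orders only through
    bounds on their derivatives. Lower orders and the waves are therefore Lipschitz along the curve,
    and min(1, |h|) <= |h|^alpha brings all of them to the scale |h|^alpha. In k + 4, a 3 comes from
    the increment of D^b g along a curve in space and k + 1 from the waves; (k + 4) / 2 <= k + 3
    then turns (k + 4) (k + 2)! / 2 into (k + 3)!. For alpha = 1 the norm is that of order k + 1 and
    the scale is |h| itself, so both cases share one counting argument with a free scale [W]. The
    chain rule along a curve calls for every axis derivative of D^b g, whereas the class C^k
    provides derivatives only in one fixed order of the axes. Symmetry of mixed derivatives thus has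
    to be proved where the existence of one of the two is part of the conclusion. Complex functions
    are carried as pairs of real ones: a modulus is the real part after rotation by a suitable
    phase, and that phase is absorbed in the trigonometric kernel. *)

Lemma continuity_2d_pt_swap (f : R -> R -> R) (x y : R) :
  continuity_2d_pt f y x -> continuity_2d_pt (fun u v => f v u) x y.
Proof.
  intros Hf eps; destruct (Hf eps) as [d Hd].
  exists d; intros u v Hu Hv; now apply Hd.
Qed.

Lemma continuity_2d_pt_continuous_r (f : R -> R -> R) (x y : R) :
  continuity_2d_pt f x y -> continuous (fun t => f x t) y.
Proof.
  intros Hf; apply continuity_pt_filterlim.
  intros eps He; destruct (Hf (mkposreal eps He)) as [d Hd].
  exists d; split; [apply cond_pos |]; intros z [_ Hz].
  apply Hd; [rewrite Rminus_diag, Rabs_R0; apply cond_pos | exact Hz].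
Qed.

Lemma ex_RInt_continuous_everywhere (f : R -> R) (a b : R) :
  (forall x, continuous f x) -> ex_RInt f a b.
Proof. intros Hf; apply (@ex_RInt_continuous R_CompleteNormedModule); auto. Qed.

(** Uniform continuity of [f] on the compact rectangle [x - 1, x + 1] x [c, d] makes the integrands
    at [u] and [x] uniformly close; reversed bounds only change a sign. *)
Lemma continuous_RInt_param (f : R -> R -> R) (c d x : R) :
  (forall u v, continuity_2d_pt f u v) ->
  continuous (fun u => RInt (f u) c d) x.
Proof.
  intros Hf.
  assert (Hex : forall u c d, ex_RInt (f u) c d).
  { intros u c' d'; apply ex_RInt_continuous_everywhere; intros t.
    now apply continuity_2d_pt_continuous_r. }
  assert (Hle : forall c d, c <= d -> continuous (fun u => RInt (f u) c d) x).
  { clear c d; intros c d Hcd.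
    apply continuity_pt_filterlim; intros eps He.
    (* The + 1 keeps the denominator positive when c = d. *)
    assert (He' : 0 < eps / (2 * (d - c + 1))) by (apply Rdiv_lt_0_compat; lra).
    destruct (uniform_continuity_2d f (x - 1) (x + 1) c d
                (fun u v _ _ => Hf u v) (mkposreal _ He')) as [del Hdel].
    exists (Rmin del 1); split; [apply Rmin_pos; [apply cond_pos | lra] |].
    intros u [_ Hu]; simpl in Hu |- *; unfold R_dist in *.
    assert (Hu1 := Rlt_le_trans _ _ _ Hu (Rmin_r _ _)).
    assert (Hu2 := Rlt_le_trans _ _ _ Hu (Rmin_l _ _)).
    apply Rabs_def2 in Hu1.
    change (Rabs (minus (RInt (f u) c d) (RInt (f x) c d)) < eps).
    rewrite <- (RInt_minus (V := R_CompleteNormedModule) (f u) (f x) c d); auto.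
    apply Rle_lt_trans with ((d - c) * (eps / (2 * (d - c + 1)))).
    - apply abs_RInt_le_const; auto.
      + apply (ex_RInt_minus (f u) (f x)); auto.
      + intros t Ht; left.
        apply (Hdel x t u t); try lra.
        rewrite Rminus_diag, Rabs_R0; apply cond_pos.
    - apply Rmult_lt_reg_r with (2 * (d - c + 1)); [lra |].
      replace ((d - c) * (eps / (2 * (d - c + 1))) * (2 * (d - c + 1)))
        with ((d - c) * eps) by (field; lra).
      nra. }
  destruct (Rle_dec c d) as [Hcd | Hcd]; [now apply Hle |].
  apply continuous_ext with (fun u => opp (RInt (f u) d c)).
  - intros u; apply opp_RInt_swap, Hex.
  - apply (continuous_opp (V := R_NormedModule)), Hle; lra.
Qed.

(** As functions of the upper bound of the [s]-integral, both sides have the same derivative, one by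
    the fundamental theorem and the other by differentiation under the integral, and both vanish at
    [a]. *)
Lemma RInt_exchange (f : R -> R -> R) (a b c d : R) :
  (forall u v, continuity_2d_pt f u v) ->
  RInt (fun s => RInt (fun t => f s t) c d) a b
  = RInt (fun t => RInt (fun s => f s t) a b) c d.
Proof.
  intros Hf.
  assert (Hf' : forall u v, continuity_2d_pt (fun s t => f t s) u v).
  { intros u v; now apply continuity_2d_pt_swap. }
  set (F := fun x t => RInt (fun s => f s t) a x).
  assert (HF : forall x t, is_derive (fun z => F z t) x (f x t)).
  { intros x t; apply (is_derive_RInt (fun s => f s t) (fun z => F z t) a).
    - apply filter_forall; intros z.
      apply (RInt_correct (V := R_CompleteNormedModule) (fun s => f s t)).
      apply ex_RInt_continuous_everywhere; intros s.
      apply (continuity_2d_pt_continuous_r (fun s t => f t s)), Hf'.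
    - apply (continuity_2d_pt_continuous_r (fun s t => f t s)), Hf'. }
  assert (HexF : forall x, ex_RInt (F x) c d).
  { intros x; apply ex_RInt_continuous_everywhere; intros t.
    apply (continuous_RInt_param (fun s t => f t s)); auto. }
  set (D := fun x => RInt (fun s => RInt (fun t => f s t) c d) a x
                     - RInt (F x) c d).
  assert (HD : forall x, is_derive D x 0).
  { intros x; unfold D.
    replace 0 with (minus (RInt (fun t => f x t) c d)
                      (RInt (fun t => Derive (fun z => F z t) x) c d)).
    2:{ rewrite (RInt_ext (fun t => Derive (fun z => F z t) x) (fun t => f x t)).
        - apply Rminus_diag.
        - intros t _; now apply is_derive_unique. }
    apply (is_derive_minus (K := R_AbsRing) (V := R_NormedModule)).
    - apply (is_derive_RInt (fun s => RInt (fun t => f s t) c d) _ a).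
      + apply filter_forall; intros z.
        apply (RInt_correct (V := R_CompleteNormedModule)).
        apply ex_RInt_continuous_everywhere; intros s.
        now apply continuous_RInt_param.
      + now apply continuous_RInt_param.
    - apply (is_derive_RInt_param F c d x).
      + apply filter_forall; intros z t _; exists (f z t); apply HF.
      + intros t _; apply continuity_2d_pt_ext with f; auto.
        intros u v; symmetry; now apply is_derive_unique.
      + apply filter_forall; auto. }
  assert (HDa : D a = 0).
  { unfold D; rewrite RInt_point.
    rewrite (RInt_ext (F a) (fun _ => 0)).
    - rewrite RInt_const; unfold zero, scal; simpl; unfold mult; simpl; ring.
    - intros t _; apply (RInt_point (V := R_CompleteNormedModule)). }
  destruct (MVT_gen D a b (fun _ => 0)) as [z [_ Hz]].
  - intros x _; apply HD.
  - intros x _; apply continuity_pt_filterlim.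
    apply (ex_derive_continuous (V := R_NormedModule)); eexists; apply HD.
  - change (RInt (fun s => RInt (fun t => f s t) c d) a b = RInt (F b) c d).
    unfold D in *; lra.
Qed.

(** The substitution moves the interval to [h, T + h]; the piece gained over [T, T + h] equals by
    periodicity the piece lost over [0, h]. *)
Lemma RInt_periodic_shift (f : R -> R) (T h : R) :
  (forall x, continuous f x) -> (forall x, f (x + T) = f x) ->
  RInt (fun t => f (t + h)) 0 T = RInt f 0 T.
Proof.
  intros Hf HT.
  assert (Hex : forall a b, ex_RInt f a b)
    by (intros; now apply ex_RInt_continuous_everywhere).
  assert (Hlin : forall v a b, RInt (fun t => f (t + v)) a b = RInt f (a + v) (b + v)).
  { intros v a b; generalize (RInt_comp_lin f 1 v a b); rewrite !Rmult_1_l.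
    intros H; rewrite <- H by auto; apply RInt_ext; intros t _.
    unfold scal; simpl; unfold mult; simpl; now rewrite !Rmult_1_l. }
  rewrite Hlin, Rplus_0_l.
  rewrite <- (RInt_Chasles f h 0 (T + h)), <- (RInt_Chasles f 0 T (T + h)) by auto.
  assert (H : RInt f T (T + h) = RInt f 0 h).
  { rewrite <- (Rplus_0_l T) at 1; rewrite (Rplus_comm T h), <- Hlin.
    apply RInt_ext; intros; apply HT. }
  rewrite H, <- (opp_RInt_swap f 0 h) by auto.
  unfold plus, opp; simpl; ring.
Qed.

Lemma polar_unit (p q : R) :
  p ^ 2 + q ^ 2 = 1 -> exists psi, cos psi = p /\ sin psi = q.
Proof.
  intros H.
  assert (Hp : -1 <= p <= 1) by nra.
  destruct (Rle_dec 0 q) as [Hq | Hq]; [exists (acos p) | exists (- acos p)].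
  - rewrite cos_acos, sin_acos by auto; split; auto.
    replace (1 - Rsqr p) with (Rsqr q) by (unfold Rsqr; lra).
    now apply sqrt_Rsqr.
  - rewrite cos_neg, sin_neg, cos_acos, sin_acos by auto; split; auto.
    replace (1 - Rsqr p) with (Rsqr (- q)) by (unfold Rsqr; lra).
    rewrite sqrt_Rsqr; lra.
Qed.

(** With psi an argument of z, the modulus is the real part of e^(-i psi) z. It reduces bounds on
    complex integrals and increments to real ones. *)
Lemma Cmod_polar (z : C) :
  exists psi, Cmod z = cos psi * fst z + sin psi * snd z.
Proof.
  assert (Hsq : Cmod z ^ 2 = fst z ^ 2 + snd z ^ 2).
  { unfold Cmod; rewrite pow2_sqrt; [reflexivity | nra]. }
  destruct (Req_dec (Cmod z) 0) as [H0 | H0].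
  - exists 0; apply Cmod_eq_0 in H0; rewrite H0, Cmod_0; simpl; ring.
  - destruct (polar_unit (fst z / Cmod z) (snd z / Cmod z)) as [psi [Hc Hs]].
    + replace ((fst z / Cmod z) ^ 2 + (snd z / Cmod z) ^ 2)
        with ((fst z ^ 2 + snd z ^ 2) / Cmod z ^ 2) by (field; auto).
      rewrite <- Hsq; field; auto.
    + exists psi; rewrite Hc, Hs.
      replace (fst z / Cmod z * fst z + snd z / Cmod z * snd z)
        with ((fst z ^ 2 + snd z ^ 2) / Cmod z) by (field; auto).
      rewrite <- Hsq; field; auto.
Qed.

(** Lagrange's identity: the squares of a cos + b sin and a sin - b cos add up to a^2 + b^2. *)
Lemma cos_sin_le_Cmod (a b psi : R) : Rabs (a * cos psi + b * sin psi) <= Cmod (a, b).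
Proof.
  unfold Cmod; simpl fst; simpl snd.
  rewrite <- sqrt_Rsqr_abs; apply sqrt_le_1_alt; unfold Rsqr.
  generalize (sin2_cos2 psi) (Rle_0_sqr (a * sin psi - b * cos psi)); unfold Rsqr; intros H1 H2.
  assert (E : (a * cos psi + b * sin psi) * (a * cos psi + b * sin psi)
      + (a * sin psi - b * cos psi) * (a * sin psi - b * cos psi)
      = (a ^ 2 + b ^ 2) * (sin psi * sin psi + cos psi * cos psi)) by ring.
  rewrite H1 in E; lra.
Qed.

(* [a] and [b] are the real and imaginary parts of one complex function. *)
Fixpoint diff_chain (h : R) (m : nat) (K : R) (a b : R -> R) : Prop :=
  match m with
  | O => (forall t, continuous a t) /\ (forall t, continuous b t) /\
         forall t, Cmod (a (t + h) - a t, b (t + h) - b t) <= K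
  | S m => exists a' b', (forall t, is_derive a t (a' t)) /\
           (forall t, is_derive b t (b' t)) /\ diff_chain h m K a' b'
  end.

Lemma diff_chain_continuous (h : R) (m : nat) (K : R) (a b : R -> R) :
  diff_chain h m K a b -> (forall t, continuous a t) /\ (forall t, continuous b t).
Proof.
  destruct m as [|m]; simpl.
  - tauto.
  - intros (a' & b' & Ha & Hb & _); split; intros t;
      apply (ex_derive_continuous (V := R_NormedModule)); eexists; eauto.
Qed.

Lemma diff_chain_ext (h : R) (m : nat) (K : R) (a b a0 b0 : R -> R) :
  (forall t, a t = a0 t) -> (forall t, b t = b0 t) ->
  diff_chain h m K a b -> diff_chain h m K a0 b0.
Proof.
  intros Ea Eb; destruct m as [|m]; simpl.
  - intros (Ha & Hb & HK); repeat split.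
    + intros t; apply continuous_ext with a; auto.
    + intros t; apply continuous_ext with b; auto.
    + intros t; rewrite <- !Ea, <- !Eb; auto.
  - intros (a' & b' & Ha & Hb & HK); exists a', b'; split; [| split]; auto; intros t.
    + apply is_derive_ext with a; auto.
    + apply is_derive_ext with b; auto.
Qed.

Lemma diff_chain_le (h : R) (m : nat) (K K' : R) (a b : R -> R) :
  K <= K' -> diff_chain h m K a b -> diff_chain h m K' a b.
Proof.
  intros HK; revert a b; induction m as [|m IH]; intros a b; simpl.
  - intros (Ha & Hb & H); repeat split; auto; intros t; specialize (H t); lra.
  - intros (a' & b' & Ha & Hb & H); exists a', b'; auto.
Qed.

Lemma diff_chain_plus (h : R) (m : nat) (K1 K2 : R) (a1 b1 a2 b2 : R -> R) :
  diff_chain h m K1 a1 b1 -> diff_chain h m K2 a2 b2 ->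
  diff_chain h m (K1 + K2) (fun t => a1 t + a2 t) (fun t => b1 t + b2 t).
Proof.
  revert a1 b1 a2 b2; induction m as [|m IH]; intros a1 b1 a2 b2; simpl.
  - intros (Ha1 & Hb1 & H1) (Ha2 & Hb2 & H2); repeat split; intros t.
    + apply (continuous_plus a1 a2); auto.
    + apply (continuous_plus b1 b2); auto.
    + eapply Rle_trans; [| apply Rplus_le_compat; [apply (H1 t) | apply (H2 t)]].
      eapply Rle_trans; [| apply Cmod_triangle].
      right; f_equal; unfold Cplus; simpl; f_equal; ring.
  - intros (a1' & b1' & Ha1 & Hb1 & H1) (a2' & b2' & Ha2 & Hb2 & H2).
    exists (fun t => a1' t + a2' t), (fun t => b1' t + b2' t); split; [| split]; auto; intros t.
    + apply (is_derive_plus a1 a2); auto.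
    + apply (is_derive_plus b1 b2); auto.
Qed.

Lemma is_derive_periodic (f f' : R -> R) (T : R) :
  (forall t, is_derive f t (f' t)) -> (forall t, f (t + T) = f t) ->
  forall t, f' (t + T) = f' t.
Proof.
  intros Hf HT t.
  rewrite <- (is_derive_unique f t (f' t)) by auto.
  symmetry; apply is_derive_unique.
  apply is_derive_ext with (fun s => f (s + T)); auto.
  replace (f' (t + T)) with (scal 1 (f' (t + T))) by (apply Rmult_1_l).
  apply (is_derive_comp f (fun s => s + T)); auto.
  auto_derive; auto.
Qed.

Definition trig_pair (a b : R -> R) (n psi t : R) : R :=
  a t * cos (n * t + psi) + b t * sin (n * t + psi).

Lemma continuous_trig_pair (a b : R -> R) (n psi : R) :
  (forall t, continuous a t) -> (forall t, continuous b t) ->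
  forall t, continuous (trig_pair a b n psi) t.
Proof.
  intros Ha Hb t; unfold trig_pair.
  apply (continuous_plus (fun t => a t * cos (n * t + psi))
           (fun t => b t * sin (n * t + psi)));
    apply (continuous_mult (K := R_AbsRing)); auto;
    apply (ex_derive_continuous (V := R_NormedModule)); auto_derive; auto.
Qed.

Lemma IZR_period (n : Z) (x : R) :
  cos (x + IZR n * (2 * PI)) = cos x /\ sin (x + IZR n * (2 * PI)) = sin x.
Proof.
  assert (Hnat : forall (m : nat) y, cos (y + INR m * (2 * PI)) = cos y /\
                                     sin (y + INR m * (2 * PI)) = sin y).
  { intros m y; replace (y + INR m * (2 * PI)) with (y + 2 * INR m * PI) by ring.
    split; [apply cos_period | apply sin_period]. }
  destruct (Z.le_gt_cases 0 n) as [Hn | Hn].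
  - rewrite <- (Z2Nat.id n) by auto; rewrite <- INR_IZR_INZ; apply Hnat.
  - destruct (Hnat (Z.to_nat (- n)) (x + IZR n * (2 * PI))) as [Hc Hs].
    rewrite <- Hc, <- Hs.
    replace (x + IZR n * (2 * PI) + INR (Z.to_nat (- n)) * (2 * PI)) with x; auto.
    rewrite INR_IZR_INZ, Z2Nat.id by lia; rewrite opp_IZR; ring.
Qed.

Lemma trig_pair_periodic (a b : R -> R) (n : Z) (psi : R) :
  (forall t, a (t + 2 * PI) = a t) -> (forall t, b (t + 2 * PI) = b t) ->
  forall t, trig_pair a b (IZR n) psi (t + 2 * PI) = trig_pair a b (IZR n) psi t.
Proof.
  intros Ha Hb t; unfold trig_pair; rewrite Ha, Hb.
  replace (IZR n * (t + 2 * PI) + psi) with (IZR n * t + psi + IZR n * (2 * PI)) by ring.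
  destruct (IZR_period n (IZR n * t + psi)) as [-> ->]; reflexivity.
Qed.

(* Differentiating [a cos + b sin] advances the phase by a quarter turn, which
   plays the role of the factor [i n] in the complex notation. *)
Lemma RInt_trig_pair_by_parts (a b a' b' : R -> R) (n : Z) (psi : R) :
  n <> 0%Z ->
  (forall t, is_derive a t (a' t)) -> (forall t, is_derive b t (b' t)) ->
  (forall t, continuous a' t) -> (forall t, continuous b' t) ->
  (forall t, a (t + 2 * PI) = a t) -> (forall t, b (t + 2 * PI) = b t) ->
  RInt (trig_pair a b (IZR n) psi) 0 (2 * PI)
  = / IZR n * RInt (trig_pair a' b' (IZR n) (psi + PI / 2)) 0 (2 * PI).
Proof.
  intros Hn Ha Hb Ca' Cb' Pa Pb.
  assert (Hn' : IZR n <> 0) by (now apply not_0_IZR).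
  assert (Ca : forall t, continuous a t)
    by (intros t; apply (ex_derive_continuous (V := R_NormedModule)); eexists; eauto).
  assert (Cb : forall t, continuous b t)
    by (intros t; apply (ex_derive_continuous (V := R_NormedModule)); eexists; eauto).
  (* [G] is a sin - b cos, so G' is [n] times the given integrand minus the integrand of the
     derivatives at the advanced phase. Periodicity makes the integral of G' vanish. *)
  set (G := trig_pair a b (IZR n) (psi - PI / 2)).
  assert (Ec : forall x, cos (x - PI / 2) = sin x).
  { intros x; rewrite cos_minus, cos_PI2, sin_PI2; ring. }
  assert (Es : forall x, sin (x - PI / 2) = - cos x).
  { intros x; rewrite sin_minus, cos_PI2, sin_PI2; ring. }
  assert (Ec' : forall x, cos (x + PI / 2) = - sin x).
  { intros x; rewrite cos_plus, cos_PI2, sin_PI2; ring. }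
  assert (Es' : forall x, sin (x + PI / 2) = cos x).
  { intros x; rewrite sin_plus, cos_PI2, sin_PI2; ring. }
  assert (HG : is_RInt (fun t => minus (scal (IZR n) (trig_pair a b (IZR n) psi t))
                 (trig_pair a' b' (IZR n) (psi + PI / 2) t)) 0 (2 * PI)
                 (minus (G (2 * PI)) (G 0))).
  { apply (is_RInt_derive G); intros t _.
    - unfold G, trig_pair.
      apply is_derive_ext with
        (fun t => a t * sin (IZR n * t + psi) - b t * cos (IZR n * t + psi)).
      { intros s; replace (IZR n * s + (psi - PI / 2)) with (IZR n * s + psi - PI / 2) by ring.
        rewrite Ec, Es; simpl; ring. }
      replace (IZR n * t + (psi + PI / 2)) with (IZR n * t + psi + PI / 2) by ring.
      rewrite Ec', Es'.
      auto_derive.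
      + repeat split; auto; eexists; eauto.
      + replace (Derive (fun x => a x) t) with (a' t)
          by (symmetry; apply is_derive_unique, Ha).
        replace (Derive (fun x => b x) t) with (b' t)
          by (symmetry; apply is_derive_unique, Hb).
        unfold minus, plus, opp, scal; simpl; unfold mult; simpl; ring.
    - apply (continuous_minus (V := R_NormedModule)).
      + apply (continuous_scal_r (V := R_NormedModule)). now apply continuous_trig_pair.
      + now apply continuous_trig_pair. }
  replace (G (2 * PI)) with (G 0) in HG.
  2:{ unfold G; rewrite <- (Rplus_0_l (2 * PI)), trig_pair_periodic; auto. }
  apply (is_RInt_unique (V := R_CompleteNormedModule)) in HG.
  rewrite (RInt_minus (V := R_CompleteNormedModule)) in HG.
  - rewrite (RInt_scal (V := R_CompleteNormedModule)) in HG.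
    + unfold minus, plus, opp, scal in HG; simpl in HG; unfold mult in HG; simpl in HG.
      apply Rmult_eq_reg_l with (IZR n); auto.
      rewrite <- Rmult_assoc, Rinv_r, Rmult_1_l by auto. lra.
    + apply ex_RInt_continuous_everywhere; now apply continuous_trig_pair.
  - apply (ex_RInt_scal (V := R_NormedModule)).
    apply ex_RInt_continuous_everywhere; now apply continuous_trig_pair.
  - apply ex_RInt_continuous_everywhere; now apply continuous_trig_pair.
Qed.

(* Shifting by the half period [PI / n] of the kernel changes its sign, so the
   integral is half the integral of a difference. *)
Lemma RInt_trig_pair_half_shift (a b : R -> R) (n : Z) (psi K : R) :
  n <> 0%Z ->
  (forall t, continuous a t) -> (forall t, continuous b t) ->
  (forall t, a (t + 2 * PI) = a t) -> (forall t, b (t + 2 * PI) = b t) ->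
  (forall t, Cmod (a (t + PI / IZR n) - a t, b (t + PI / IZR n) - b t) <= K) ->
  Rabs (RInt (trig_pair a b (IZR n) psi) 0 (2 * PI)) <= PI * K.
Proof.
  intros Hn Ca Cb Pa Pb HK.
  assert (Hn' : IZR n <> 0) by (now apply not_0_IZR).
  set (h := PI / IZR n) in *.
  set (f := trig_pair a b (IZR n) psi).
  assert (Cf : forall t, continuous f t) by (now apply continuous_trig_pair).
  assert (Cfh : forall t, continuous (fun t => f (t + h)) t).
  { intros t; apply (continuous_comp (fun t => t + h) f); auto.
    apply (ex_derive_continuous (V := R_NormedModule)); auto_derive; auto. }
  assert (Hshift : RInt (fun t => f (t + h)) 0 (2 * PI) = RInt f 0 (2 * PI)).
  { apply RInt_periodic_shift; auto; intros; now apply trig_pair_periodic. }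
  assert (Hsum : plus (RInt f 0 (2 * PI)) (RInt (fun t => f (t + h)) 0 (2 * PI))
                 = RInt (fun t => plus (f t) (f (t + h))) 0 (2 * PI)).
  { rewrite (RInt_plus (V := R_CompleteNormedModule)); auto;
      now apply ex_RInt_continuous_everywhere. }
  rewrite Hshift in Hsum; unfold plus in Hsum; simpl in Hsum.
  assert (Hb : Rabs (RInt (fun t => f t + f (t + h)) 0 (2 * PI)) <= (2 * PI - 0) * K).
  { apply abs_RInt_le_const.
    - generalize PI_RGT_0; lra.
    - apply ex_RInt_continuous_everywhere; intros t.
      apply (continuous_plus f (fun t => f (t + h))); auto.
    - intros t _; unfold f, trig_pair.
      replace (IZR n * (t + h) + psi) with (IZR n * t + psi + PI)
        by (unfold h; field; auto).
      rewrite neg_cos, neg_sin.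
      eapply Rle_trans; [| apply (HK t)].
      eapply Rle_trans; [| apply (cos_sin_le_Cmod _ _ (IZR n * t + psi))].
      rewrite <- Rabs_Ropp; right; f_equal; ring. }
  rewrite <- Hsum in Hb.
  replace (RInt f 0 (2 * PI) + RInt f 0 (2 * PI)) with (2 * RInt f 0 (2 * PI)) in Hb by ring.
  rewrite Rabs_mult, (Rabs_pos_eq 2) in Hb by lra; lra.
Qed.

(** Each integration by parts gains 1 / |n| and consumes one level of the chain; the half shift is
    applied at the last level. The phase changes on the way, so the induction keeps [psi]
    general. *)
Lemma RInt_trig_pair_decay (k : nat) (a b : R -> R) (n : Z) (psi K : R) :
  n <> 0%Z -> diff_chain (PI / IZR n) k K a b ->
  (forall t, a (t + 2 * PI) = a t) -> (forall t, b (t + 2 * PI) = b t) ->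
  Rabs (RInt (trig_pair a b (IZR n) psi) 0 (2 * PI)) <= PI * K / Rabs (IZR n) ^ k.
Proof.
  intros Hn; revert a b psi; induction k as [|k IH]; intros a b psi Hch Pa Pb.
  - destruct Hch as (Ca & Cb & HK); simpl; rewrite Rdiv_1_r.
    now apply RInt_trig_pair_half_shift.
  - destruct Hch as (a' & b' & Da & Db & Hch).
    destruct (diff_chain_continuous _ _ _ _ _ Hch) as [Ca' Cb'].
    rewrite (RInt_trig_pair_by_parts a b a' b') by auto.
    assert (Hn' : 0 < Rabs (IZR n)) by (now apply Rabs_pos_lt, not_0_IZR).
    rewrite Rabs_mult, Rabs_inv.
    replace (PI * K / Rabs (IZR n) ^ S k)
      with (/ Rabs (IZR n) * (PI * K / Rabs (IZR n) ^ k)).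
    2:{ simpl; field; split; [apply pow_nonzero |]; lra. }
    apply Rmult_le_compat_l; [left; now apply Rinv_0_lt_compat |].
    apply IH; auto; eapply is_derive_periodic; eauto.
Qed.

(** * Partial derivatives in space *)

(** Neighbourhoods in the maximum norm bound each coordinate separately, which suits mean value
    arguments that move along one axis at a time. *)
Definition box3 (d : R) (x y : P3) : Prop :=
  Rabs (p1 y - p1 x) < d /\ Rabs (p2 y - p2 x) < d /\ Rabs (p3 y - p3 x) < d.

Definition is_pd (i : nat) (h : P3 -> R) (x : P3) (l : R) : Prop :=
  is_derive (fun t => h (shift3 i x t)) 0 l.

Definition cont3 (h : P3 -> R) (x : P3) : Prop :=
  forall eps, 0 < eps -> exists d, 0 < d /\
    forall y, box3 d x y -> Rabs (h y - h x) < eps.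

Lemma enorm3_le_sum (x : P3) :
  enorm3 x <= Rabs (p1 x) + Rabs (p2 x) + Rabs (p3 x).
Proof.
  unfold enorm3.
  generalize (Rabs_pos (p1 x)) (Rabs_pos (p2 x)) (Rabs_pos (p3 x)); intros H1 H2 H3.
  rewrite <- (sqrt_Rsqr (Rabs (p1 x) + Rabs (p2 x) + Rabs (p3 x))) by lra.
  apply sqrt_le_1_alt; unfold Rsqr.
  rewrite <- (pow2_abs (p1 x)), <- (pow2_abs (p2 x)), <- (pow2_abs (p3 x)); nra.
Qed.

Lemma box3_enorm3 (d : R) (x y : P3) : box3 (d / 3) x y -> enorm3 (sub3 y x) < d.
Proof.
  intros (H1 & H2 & H3).
  eapply Rle_lt_trans; [apply enorm3_le_sum |]; simpl; lra.
Qed.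

Lemma open3_box (U : P3 -> Prop) (x : P3) :
  open3 U -> U x -> exists d, 0 < d /\ forall y, box3 d x y -> U y.
Proof.
  intros HU Hx; destruct (HU x Hx) as (r & Hr & H).
  exists (r / 3); split; [lra |]; intros y Hy; apply H, box3_enorm3, Hy.
Qed.

Lemma box3_le (d d' : R) (x y : P3) : d <= d' -> box3 d x y -> box3 d' x y.
Proof. unfold box3; intros Hd (H1 & H2 & H3); lra. Qed.

Lemma box3_shift2 (d : R) (i j : nat) (x : P3) (s t : R) :
  Rabs s < d / 2 -> Rabs t < d / 2 -> box3 d x (shift3 i (shift3 j x t) s).
Proof.
  intros Hs Ht; apply Rabs_def2 in Hs; apply Rabs_def2 in Ht.
  destruct i as [|[|i]], j as [|[|j]]; repeat split; simpl; apply Rabs_def1; lra.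
Qed.

Lemma shift3_shift3_same (i : nat) (x : P3) (s t : R) :
  shift3 i (shift3 i x s) t = shift3 i x (s + t).
Proof. destruct i as [|[|i]]; simpl; f_equal; ring. Qed.

Lemma shift3_comm (i j : nat) (x : P3) (s t : R) :
  shift3 i (shift3 j x t) s = shift3 j (shift3 i x s) t.
Proof. destruct i as [|[|i]], j as [|[|j]]; simpl; f_equal; ring. Qed.

Lemma shift3_0 (i : nat) (x : P3) : shift3 i x 0 = x.
Proof. destruct x; destruct i as [|[|i]]; simpl; f_equal; ring. Qed.

(** [is_pd] speaks of the parameter 0 only; moving the base point along the axis gives the
    derivative at every point of the line, as the mean value theorem requires. *)
Lemma is_pd_line (i : nat) (h : P3 -> R) (x : P3) (t l : R) :
  is_pd i h (shift3 i x t) l -> is_derive (fun s => h (shift3 i x s)) t l.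
Proof.
  intros H.
  apply is_derive_ext with (fun s => h (shift3 i (shift3 i x t) (s - t))).
  { intros s; rewrite shift3_shift3_same; do 2 f_equal; ring. }
  replace l with (scal 1 l) by (apply Rmult_1_l).
  apply (is_derive_comp (fun s => h (shift3 i (shift3 i x t) s)) (fun s => s - t)).
  - rewrite Rminus_diag; exact H.
  - auto_derive; [auto | ring].
Qed.

Lemma MVT_0 (f df : R -> R) (d b : R) :
  (forall x, Rabs x < d -> is_derive f x (df x)) -> Rabs b < d ->
  exists c, Rabs c < d /\ f b - f 0 = df c * b.
Proof.
  intros Hf Hb.
  assert (Hm : forall x, Rmin 0 b <= x <= Rmax 0 b -> Rabs x < d).
  { intros x Hx; apply Rabs_def2 in Hb; revert Hx.
    unfold Rmin, Rmax; destruct (Rle_dec 0 b); intros; apply Rabs_def1; lra. }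
  destruct (MVT_gen f 0 b df) as (c & Hc & E).
  - intros x Hx; apply Hf, Hm; lra.
  - intros x Hx; apply continuity_pt_filterlim.
    apply (ex_derive_continuous (V := R_NormedModule)); eexists; apply Hf, Hm, Hx.
  - exists c; split; [now apply Hm |]; rewrite E; ring.
Qed.

(* Only one of the two mixed derivatives is assumed to exist: the other one is
   obtained as an iterated limit of the second-order difference quotient. *)
Lemma is_pd_swap (U : P3 -> Prop) (i j : nat) (h h1 h2 h12 : P3 -> R) :
  open3 U ->
  (forall x, U x -> is_pd i h x (h1 x)) ->
  (forall x, U x -> is_pd j h x (h2 x)) ->
  (forall x, U x -> is_pd i h2 x (h12 x)) ->
  (forall x, U x -> cont3 h12 x) ->
  forall x, U x -> is_pd j h1 x (h12 x).
Proof.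
  intros HU H1 H2 H12 Hc x Hx; apply is_derive_Reals; intros eps He.
  destruct (open3_box U x HU Hx) as (d0 & Hd0 & HUb).
  destruct (Hc x Hx (eps / 2)) as (d1 & Hd1 & Hcb); [lra |].
  (* Halved because the axes [i] and [j] may coincide, in which case the two shifts add up in one
     coordinate. *)
  set (d := Rmin d0 d1 / 2).
  assert (Hd : 0 < d) by (unfold d; generalize (Rmin_pos _ _ Hd0 Hd1); lra).
  set (P := fun s t => shift3 i (shift3 j x t) s).
  assert (HP : forall s t, Rabs s < d -> Rabs t < d ->
            U (P s t) /\ Rabs (h12 (P s t) - h12 x) < eps / 2).
  { intros s t Hs Ht; assert (Hb : box3 (Rmin d0 d1) x (P s t)) by (now apply box3_shift2).
    split.
    - apply HUb; eapply box3_le; [apply Rmin_l | exact Hb].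
    - apply Hcb; eapply box3_le; [apply Rmin_r | exact Hb]. }
  assert (H0 : Rabs 0 < d) by (now rewrite Rabs_R0).
  exists (mkposreal d Hd); simpl; intros t Ht0 Ht.
  rewrite Rplus_0_l.
  (* The second-order difference equals m s t with [m] a value of [h12] near [x]: the mean value
     theorem is applied along axis [j] to a difference in direction [i], then along axis [i] to
     [h2]. *)
  assert (Hquot : forall s, Rabs s < d ->
    exists m, Rabs (m - h12 x) < eps / 2 /\
      (h (P s t) - h (P s 0)) - (h (P 0 t) - h (P 0 0)) = m * s * t).
  { intros s Hs.
    destruct (MVT_0 (fun u => h (P s u) - h (P 0 u)) (fun u => h2 (P s u) - h2 (P 0 u)) d t)
      as (u & Hu & E); auto.
    { intros u Hu; apply (is_derive_minus (K := R_AbsRing) (V := R_NormedModule)).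
      - apply is_derive_ext with (fun u => h (shift3 j (shift3 i x s) u)).
        + intros u'; unfold P; now rewrite shift3_comm.
        + unfold P; rewrite shift3_comm; apply is_pd_line, H2.
          rewrite shift3_comm; now apply HP.
      - apply is_derive_ext with (fun u => h (shift3 j (shift3 i x 0) u)).
        + intros u'; unfold P; now rewrite shift3_comm.
        + unfold P; rewrite shift3_comm; apply is_pd_line, H2.
          rewrite shift3_comm; now apply HP. }
    destruct (MVT_0 (fun v => h2 (P v u)) (fun v => h12 (P v u)) d s) as (v & Hv & E'); auto.
    { intros v Hv; apply is_pd_line, H12; now apply HP. }
    exists (h12 (P v u)); split; [now apply HP |].
    cbv beta in E, E'; rewrite <- E'; lra. }
  assert (HL : is_derive (fun s => h (P s t) - h (P s 0)) 0 (h1 (P 0 t) - h1 (P 0 0))).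
  { apply (is_derive_minus (K := R_AbsRing) (V := R_NormedModule));
      apply is_pd_line, H1; now apply HP. }
  assert (E0 : forall u, shift3 j x u = P 0 u) by (intros u; unfold P; now rewrite shift3_0).
  rewrite !E0.
  set (L := h1 (P 0 t) - h1 (P 0 0)) in *.
  assert (Htp : 0 < Rabs t) by (now apply Rabs_pos_lt).
  (* Divided by [s], the second-order difference tends to the increment [L] of [h1]. The bound
     becomes non-strict in the limit s -> 0, which is why it was set at eps / 2. *)
  assert (Hlim : Rabs (L - h12 x * t) <= eps / 2 * Rabs t).
  { apply le_epsilon; intros eta Heta.
    apply is_derive_Reals in HL; destruct (HL eta Heta) as [ds Hds].
    set (s := Rmin d ds / 2).
    assert (Hs : 0 < s < d /\ s < ds).
    { generalize (Rmin_l d ds) (Rmin_r d ds) (Rmin_pos d ds Hd (cond_pos ds)); unfold s; lra. }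
    assert (Ha : Rabs s = s) by (apply Rabs_pos_eq; lra).
    specialize (Hds s); rewrite Rplus_0_l, Ha in Hds.
    destruct (Hquot s) as (m & Hm & E); [rewrite Ha; lra |].
    cbv beta in Hds; rewrite E in Hds.
    replace (m * s * t / s) with (m * t) in Hds by (field; lra).
    replace (L - h12 x * t) with ((m - h12 x) * t - (m * t - L)) by ring.
    eapply Rle_trans; [apply Rabs_triang |]; rewrite Rabs_Ropp, Rabs_mult.
    apply Rplus_le_compat; [apply Rmult_le_compat_r; lra | left; apply Hds; lra]. }
  replace (L / t - h12 x) with ((L - h12 x * t) / t) by (field; auto).
  unfold Rdiv; rewrite Rabs_mult, Rabs_inv.
  apply Rle_lt_trans with (eps / 2 * Rabs t * / Rabs t).
  - apply Rmult_le_compat_r; [left; now apply Rinv_0_lt_compat | exact Hlim].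
  - rewrite Rmult_assoc, Rinv_r by lra; lra.
Qed.

(** From [x] to [y] one travels along three axis-parallel segments; the mean value theorem on each
    gives a partial derivative at an intermediate point, and continuity at [x] replaces it by the
    value at [x]. *)
Lemma is_pd_differentiable (U : P3 -> Prop) (h h0 h1 h2 : P3 -> R) (x : P3) :
  open3 U -> U x ->
  (forall y, U y -> is_pd 0 h y (h0 y)) ->
  (forall y, U y -> is_pd 1 h y (h1 y)) ->
  (forall y, U y -> is_pd 2 h y (h2 y)) ->
  cont3 h0 x -> cont3 h1 x -> cont3 h2 x ->
  forall eps, 0 < eps -> exists d, 0 < d /\ forall y, box3 d x y ->
    Rabs (h y - h x - (h0 x * (p1 y - p1 x) + h1 x * (p2 y - p2 x) + h2 x * (p3 y - p3 x)))
    <= eps * (Rabs (p1 y - p1 x) + Rabs (p2 y - p2 x) + Rabs (p3 y - p3 x)).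
Proof.
  intros HU Hx D0 D1 D2 C0 C1 C2 eps He.
  destruct (open3_box U x HU Hx) as (d & Hd & HUb).
  destruct (C0 eps He) as (e0 & He0 & K0).
  destruct (C1 eps He) as (e1 & He1 & K1).
  destruct (C2 eps He) as (e2 & He2 & K2).
  set (r := Rmin d (Rmin e0 (Rmin e1 e2))).
  assert (Hr : 0 < r /\ r <= d /\ r <= e0 /\ r <= e1 /\ r <= e2).
  { unfold r; repeat split.
    - repeat apply Rmin_pos; auto.
    - apply Rmin_l.
    - eapply Rle_trans; [apply Rmin_r | apply Rmin_l].
    - eapply Rle_trans; [apply Rmin_r |]; eapply Rle_trans; [apply Rmin_r | apply Rmin_l].
    - eapply Rle_trans; [apply Rmin_r |]; eapply Rle_trans; [apply Rmin_r | apply Rmin_r]. }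
  destruct Hr as (Hr & Hrd & Hr0 & Hr1 & Hr2).
  exists r; split; auto; intros y (Hy1 & Hy2 & Hy3).
  set (a := p1 y - p1 x) in *; set (b := p2 y - p2 x) in *; set (c := p3 y - p3 x) in *.
  assert (Hz : Rabs 0 < r) by (now rewrite Rabs_R0).
  assert (Hbox : forall u v w, Rabs u < r -> Rabs v < r -> Rabs w < r ->
            box3 r x (shift3 2 (shift3 1 (shift3 0 x u) v) w)).
  { intros u v w Hu Hv Hw; repeat split; simpl;
      match goal with |- Rabs (?X + ?u - ?X) < _ =>
        replace (X + u - X) with u by ring; assumption end. }
  assert (HU3 : forall u v w, Rabs u < r -> Rabs v < r -> Rabs w < r ->
            U (shift3 2 (shift3 1 (shift3 0 x u) v) w)).
  { intros; apply HUb; eapply box3_le; [exact Hrd | auto]. }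
  destruct (MVT_0 (fun u => h (shift3 0 x u)) (fun u => h0 (shift3 0 x u)) r a)
    as (u & Hu & E0); auto.
  { intros u Hu; apply is_pd_line, D0.
    rewrite <- (shift3_0 1), <- (shift3_0 2); auto. }
  destruct (MVT_0 (fun v => h (shift3 1 (shift3 0 x a) v))
              (fun v => h1 (shift3 1 (shift3 0 x a) v)) r b) as (v & Hv & E1); auto.
  { intros v Hv; apply is_pd_line, D1.
    rewrite <- (shift3_0 2); auto. }
  destruct (MVT_0 (fun w => h (shift3 2 (shift3 1 (shift3 0 x a) b) w))
              (fun w => h2 (shift3 2 (shift3 1 (shift3 0 x a) b) w)) r c) as (w & Hw & E2); auto.
  { intros w Hw; apply is_pd_line, D2; auto. }
  cbv beta in E0, E1, E2; rewrite !shift3_0 in E0, E1, E2.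
  assert (Ey : shift3 2 (shift3 1 (shift3 0 x a) b) c = y).
  { destruct y; unfold a, b, c; simpl; f_equal; ring. }
  rewrite Ey in E2.
  assert (G0 : Rabs (h0 (shift3 0 x u) - h0 x) < eps).
  { apply K0; eapply box3_le; [exact Hr0 |].
    rewrite <- (shift3_0 1), <- (shift3_0 2); auto. }
  assert (G1 : Rabs (h1 (shift3 1 (shift3 0 x a) v) - h1 x) < eps).
  { apply K1; eapply box3_le; [exact Hr1 |].
    rewrite <- (shift3_0 2); auto. }
  assert (G2 : Rabs (h2 (shift3 2 (shift3 1 (shift3 0 x a) b) w) - h2 x) < eps).
  { apply K2; eapply box3_le; [exact Hr2 |]; auto. }
  replace (h y - h x - (h0 x * a + h1 x * b + h2 x * c)) with
    ((h0 (shift3 0 x u) - h0 x) * a + (h1 (shift3 1 (shift3 0 x a) v) - h1 x) * b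
     + (h2 (shift3 2 (shift3 1 (shift3 0 x a) b) w) - h2 x) * c) by lra.
  rewrite !Rmult_plus_distr_l.
  eapply Rle_trans; [apply Rabs_triang |]; apply Rplus_le_compat;
    [eapply Rle_trans; [apply Rabs_triang |]; apply Rplus_le_compat |];
    rewrite Rabs_mult; apply Rmult_le_compat_r; (apply Rabs_pos || lra).
Qed.

(** Without the quotient the estimate also covers s = 0, and such error bounds can be added up in
    the chain rule below. *)
Lemma is_derive_difference_bound (f : R -> R) (t l : R) :
  is_derive f t l -> forall eps, 0 < eps -> exists d, 0 < d /\ forall s, Rabs s < d ->
    Rabs (f (t + s) - f t - l * s) <= eps * Rabs s.
Proof.
  intros Hf eps He; apply is_derive_Reals in Hf.
  destruct (Hf eps He) as [d Hd]; exists d; split; [apply cond_pos |].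
  intros s Hs; destruct (Req_dec s 0) as [-> | Hs0].
  - rewrite Rplus_0_r, Rabs_R0, Rmult_0_r, !Rmult_0_r.
    replace (f t - f t - 0) with 0 by ring; rewrite Rabs_R0; lra.
  - specialize (Hd s Hs0 Hs).
    replace (f (t + s) - f t - l * s) with (((f (t + s) - f t) / s - l) * s) by (field; auto).
    rewrite Rabs_mult; apply Rmult_le_compat_r; [apply Rabs_pos | lra].
Qed.

Lemma difference_bound_is_derive (f : R -> R) (t l : R) :
  (forall eps, 0 < eps -> exists d, 0 < d /\ forall s, Rabs s < d ->
    Rabs (f (t + s) - f t - l * s) <= eps * Rabs s) -> is_derive f t l.
Proof.
  intros H; apply is_derive_Reals; intros eps He.
  destruct (H (eps / 2)) as (d & Hd & Hb); [lra |].
  exists (mkposreal d Hd); intros s Hs0 Hs; specialize (Hb s Hs).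
  assert (Hp : 0 < Rabs s) by (now apply Rabs_pos_lt).
  replace ((f (t + s) - f t) / s - l) with ((f (t + s) - f t - l * s) / s) by (field; auto).
  unfold Rdiv; rewrite Rabs_mult, Rabs_inv.
  apply Rle_lt_trans with (eps / 2 * Rabs s * / Rabs s).
  - apply Rmult_le_compat_r; [left; now apply Rinv_0_lt_compat | exact Hb].
  - rewrite Rmult_assoc, Rinv_r by lra; lra.
Qed.

Lemma is_derive_comp_curve (U : P3 -> Prop) (h h0 h1 h2 : P3 -> R)
    (x1 x2 x3 : R -> R) (t l1 l2 l3 : R) :
  open3 U -> U (mkP3 (x1 t) (x2 t) (x3 t)) ->
  (forall y, U y -> is_pd 0 h y (h0 y)) ->
  (forall y, U y -> is_pd 1 h y (h1 y)) ->
  (forall y, U y -> is_pd 2 h y (h2 y)) ->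
  (forall y, U y -> cont3 h0 y) -> (forall y, U y -> cont3 h1 y) ->
  (forall y, U y -> cont3 h2 y) ->
  is_derive x1 t l1 -> is_derive x2 t l2 -> is_derive x3 t l3 ->
  is_derive (fun s => h (mkP3 (x1 s) (x2 s) (x3 s))) t
    (h0 (mkP3 (x1 t) (x2 t) (x3 t)) * l1 + h1 (mkP3 (x1 t) (x2 t) (x3 t)) * l2
     + h2 (mkP3 (x1 t) (x2 t) (x3 t)) * l3).
Proof.
  intros HU Hx D0 D1 D2 C0 C1 C2 X1 X2 X3.
  set (x := mkP3 (x1 t) (x2 t) (x3 t)) in *.
  apply difference_bound_is_derive; intros eps He.
  (* One constant dominates the sum of the partial derivatives and the sum of the increment rates
     |l| + 1. *)
  set (B := Rabs (h0 x) + Rabs (h1 x) + Rabs (h2 x) + Rabs l1 + Rabs l2 + Rabs l3 + 3).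
  assert (HB : Rabs (h0 x) + Rabs (h1 x) + Rabs (h2 x) <= B
               /\ Rabs l1 + Rabs l2 + Rabs l3 + 3 <= B /\ 0 < B
               /\ Rabs l1 + 1 <= B /\ Rabs l2 + 1 <= B /\ Rabs l3 + 1 <= B).
  { unfold B; generalize (Rabs_pos (h0 x)) (Rabs_pos (h1 x)) (Rabs_pos (h2 x))
      (Rabs_pos l1) (Rabs_pos l2) (Rabs_pos l3); lra. }
  clearbody B; destruct HB as (HBh & HBl & HB & HB1 & HB2 & HB3).
  (* The bound e <= 1 keeps each coordinate increment below (|l| + 1) |s|; the bound e B <= eps / 2
     serves both halves of the error. *)
  set (e := Rmin 1 (eps / (2 * B))).
  assert (He' : 0 < e /\ e <= 1 /\ e * B <= eps / 2).
  { assert (Hq : 0 < eps / (2 * B)) by (apply Rdiv_lt_0_compat; lra).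
    split; [| split].
    - apply Rmin_pos; lra.
    - apply Rmin_l.
    - replace (eps / 2) with (eps / (2 * B) * B) by (field; lra).
      apply Rmult_le_compat_r; [lra | apply Rmin_r]. }
  destruct He' as (Hep & He1 & HeB).
  destruct (is_pd_differentiable U h h0 h1 h2 x HU Hx D0 D1 D2 (C0 _ Hx) (C1 _ Hx) (C2 _ Hx)
              e Hep) as (r & Hr & Hdiff).
  destruct (is_derive_difference_bound _ _ _ X1 e Hep) as (d1 & Hd1 & B1).
  destruct (is_derive_difference_bound _ _ _ X2 e Hep) as (d2 & Hd2 & B2).
  destruct (is_derive_difference_bound _ _ _ X3 e Hep) as (d3 & Hd3 & B3).
  assert (Hrb : 0 < r / B) by (now apply Rdiv_lt_0_compat).
  (* The radius r / B keeps the coordinate increments, at most B |s|, inside the box on which [h] is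
     close to linear. *)
  exists (Rmin (r / B) (Rmin d1 (Rmin d2 d3))); split; [repeat apply Rmin_pos; auto |].
  intros s Hs.
  assert (Hsr := Rlt_le_trans _ _ _ Hs (Rmin_l _ _)).
  assert (Hs' := Rlt_le_trans _ _ _ Hs (Rmin_r _ _)); clear Hs.
  assert (Hs1 := Rlt_le_trans _ _ _ Hs' (Rmin_l _ _)).
  assert (Hs'' := Rlt_le_trans _ _ _ Hs' (Rmin_r _ _)); clear Hs'.
  assert (Hs2 := Rlt_le_trans _ _ _ Hs'' (Rmin_l _ _)).
  assert (Hs3 := Rlt_le_trans _ _ _ Hs'' (Rmin_r _ _)); clear Hs''.
  specialize (B1 s Hs1); specialize (B2 s Hs2); specialize (B3 s Hs3).
  assert (Hsp := Rabs_pos s).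
  assert (Hsize : forall D l, Rabs (D - l * s) <= e * Rabs s ->
            Rabs D <= (Rabs l + 1) * Rabs s).
  { intros D l HD; replace D with ((D - l * s) + l * s) by ring.
    eapply Rle_trans; [apply Rabs_triang |]; rewrite Rabs_mult; nra. }
  assert (S1 := Hsize _ _ B1); assert (S2 := Hsize _ _ B2); assert (S3 := Hsize _ _ B3).
  assert (Hbig : forall D m, Rabs D <= m * Rabs s -> m <= B -> Rabs D < r).
  { intros D m HD Hm; apply Rle_lt_trans with (B * Rabs s); [nra |].
    apply Rmult_lt_reg_r with (/ B); [now apply Rinv_0_lt_compat |].
    replace (B * Rabs s * / B) with (Rabs s) by (field; lra); exact Hsr. }
  specialize (Hdiff (mkP3 (x1 (t + s)) (x2 (t + s)) (x3 (t + s)))).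
  unfold box3 in Hdiff; simpl p1 in Hdiff; simpl p2 in Hdiff; simpl p3 in Hdiff.
  change (p1 x) with (x1 t) in Hdiff; change (p2 x) with (x2 t) in Hdiff;
    change (p3 x) with (x3 t) in Hdiff.
  assert (Hdiff' := Hdiff (conj (Hbig _ _ S1 HB1) (conj (Hbig _ _ S2 HB2) (Hbig _ _ S3 HB3)))).
  clear Hdiff Hbig Hsize.
  set (y := mkP3 (x1 (t + s)) (x2 (t + s)) (x3 (t + s))) in *.
  set (D1' := x1 (t + s) - x1 t) in *; set (D2' := x2 (t + s) - x2 t) in *;
    set (D3' := x3 (t + s) - x3 t) in *.
  change (Rabs (h y - h x - (h0 x * l1 + h1 x * l2 + h2 x * l3) * s) <= eps * Rabs s).
  (* The error splits into that of linearizing [h] and that of linearizing the three coordinates. *)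
  replace (h y - h x - (h0 x * l1 + h1 x * l2 + h2 x * l3) * s) with
    ((h y - h x - (h0 x * D1' + h1 x * D2' + h2 x * D3'))
     + (h0 x * (D1' - l1 * s) + h1 x * (D2' - l2 * s) + h2 x * (D3' - l3 * s))) by ring.
  eapply Rle_trans; [apply Rabs_triang |].
  assert (T1 : e * (Rabs D1' + Rabs D2' + Rabs D3') <= eps / 2 * Rabs s).
  { apply Rle_trans with (e * (B * Rabs s)); [apply Rmult_le_compat_l; nra | nra]. }
  assert (T2 : Rabs (h0 x * (D1' - l1 * s) + h1 x * (D2' - l2 * s) + h2 x * (D3' - l3 * s))
               <= eps / 2 * Rabs s).
  { apply Rle_trans with ((Rabs (h0 x) + Rabs (h1 x) + Rabs (h2 x)) * (e * Rabs s)).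
    - rewrite !Rmult_plus_distr_r.
      eapply Rle_trans; [apply Rabs_triang |]; apply Rplus_le_compat;
        [eapply Rle_trans; [apply Rabs_triang |]; apply Rplus_le_compat |];
        rewrite Rabs_mult; apply Rmult_le_compat_l; auto using Rabs_pos.
    - apply Rle_trans with (B * (e * Rabs s)); [apply Rmult_le_compat_r; nra | nra]. }
  lra.
Qed.

Definition mi_incr (i : nat) (b : mi) : mi :=
  let '(b1, b2, b3) := b in
  match i with
  | 0%nat => (S b1, b2, b3)
  | 1%nat => (b1, S b2, b3)
  | _ => (b1, b2, S b3)
  end.

Lemma mi_abs_incr (i : nat) (b : mi) : mi_abs (mi_incr i b) = S (mi_abs b).
Proof. destruct b as [[b1 b2] b3]; destruct i as [|[|i]]; simpl; lia. Qed.

Section DerivativesOfCk.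

Variables (U : P3 -> Prop) (K : nat) (g : P3 -> C) (c : C -> R).
Hypothesis HU : open3 U.
Hypothesis Hg : Ck U K g.
Hypothesis Hc : c = fst \/ c = snd.

Lemma component_le_Cmod (z w : C) : Rabs (c z - c w) <= Cmod (Cminus z w).
Proof.
  eapply Rle_trans; [| apply Rmax_Cmod].
  destruct Hc as [-> | ->]; [apply Rmax_l | apply Rmax_r].
Qed.

Lemma Dbeta_cont3 (b : mi) :
  (mi_abs b <= K)%nat -> forall x, U x -> cont3 (fun y => c (Dbeta b g y)) x.
Proof.
  intros Hb x Hx eps He.
  destruct (Hg b Hb) as (_ & _ & Hu); destruct (Hu eps He) as (d & Hd & H).
  destruct (open3_box U x HU Hx) as (r & Hr & HUb).
  exists (Rmin r (d / 3)); split; [apply Rmin_pos; lra |]; intros y Hy.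
  eapply Rle_lt_trans; [apply component_le_Cmod |]; apply H; auto.
  - apply HUb; eapply box3_le; [apply Rmin_l | exact Hy].
  - apply box3_enorm3; eapply box3_le; [apply Rmin_r | exact Hy].
Qed.

(** Membership in C^k directly supplies the derivative taken last, which is the head of the list of
    axes. *)
Lemma Dbeta_pd_head (i : nat) (b b' : mi) :
  (mi_abs b' <= K)%nat -> mi_list b' = i :: mi_list b ->
  forall x, U x -> is_pd i (fun y => c (Dbeta b g y)) x (c (Dbeta b' g x)).
Proof.
  intros Hb E x Hx.
  destruct (Hg b' Hb) as (He & _ & _); unfold Dbeta_exists in He; rewrite E in He.
  destruct He as [_ He]; destruct (He x Hx) as [Hf Hs].
  unfold Dbeta at 2; rewrite E; unfold is_pd.
  destruct Hc as [-> | ->]; simpl; now apply Derive_correct.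
Qed.

(** The list of axes is sorted, so a new derivative along axis [i] belongs behind all derivatives
    along smaller axes. It is moved past them one at a time by [is_pd_swap], which also yields that
    the derivative in the new order exists. *)
Lemma Dbeta_pd (i : nat) (b : mi) :
  (i < 3)%nat -> (mi_abs b < K)%nat ->
  forall x, U x -> is_pd i (fun y => c (Dbeta b g y)) x (c (Dbeta (mi_incr i b) g x)).
Proof.
  (* If the derivative along [j] is known for [b], it is known after one more derivative along [i],
     provided [i] heads the lists concerned. *)
  assert (Hstep : forall i j b, mi_list (mi_incr i b) = i :: mi_list b ->
    mi_list (mi_incr j (mi_incr i b)) = i :: mi_list (mi_incr j b) ->
    (mi_abs (mi_incr i b) < K)%nat ->
    (forall x, U x -> is_pd j (fun y => c (Dbeta b g y)) x (c (Dbeta (mi_incr j b) g x))) ->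
    forall x, U x -> is_pd j (fun y => c (Dbeta (mi_incr i b) g y)) x
                       (c (Dbeta (mi_incr j (mi_incr i b)) g x))).
  { clear i b; intros i j b E1 E2 Hb Hj; rewrite mi_abs_incr in Hb.
    apply (is_pd_swap U i j (fun y => c (Dbeta b g y)) (fun y => c (Dbeta (mi_incr i b) g y))
             (fun y => c (Dbeta (mi_incr j b) g y))
             (fun y => c (Dbeta (mi_incr j (mi_incr i b)) g y))); auto.
    - apply Dbeta_pd_head; auto; rewrite mi_abs_incr; lia.
    - apply Dbeta_pd_head; auto; rewrite !mi_abs_incr; lia.
    - apply Dbeta_cont3; rewrite !mi_abs_incr; lia. }
  destruct b as [[b1 b2] b3]; intros Hi; destruct i as [|[|[|i]]]; [| | | lia].
  - intros Hb; apply Dbeta_pd_head; [simpl in *; lia | reflexivity].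
  - induction b1 as [|b1 IH]; intros Hb.
    + apply Dbeta_pd_head; [simpl in *; lia | reflexivity].
    + apply (Hstep 0%nat 1%nat (b1, b2, b3)); auto; apply IH; simpl in *; lia.
  (* The third axis has to pass the derivatives along the first axis, by the outer induction, and
     those along the second, by the inner one. *)
  - induction b1 as [|b1 IH]; intros Hb.
    + induction b2 as [|b2 IH].
      * apply Dbeta_pd_head; [simpl in *; lia | reflexivity].
      * apply (Hstep 1%nat 2%nat (0%nat, b2, b3)); auto; apply IH; simpl in *; lia.
    + apply (Hstep 0%nat 2%nat (b1, b2, b3)); auto; apply IH; simpl in *; lia.
Qed.

Lemma is_derive_Dbeta_curve (b : mi) (x1 x2 x3 : R -> R) (t l1 l2 l3 : R) :
  (mi_abs b < K)%nat -> U (mkP3 (x1 t) (x2 t) (x3 t)) ->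
  is_derive x1 t l1 -> is_derive x2 t l2 -> is_derive x3 t l3 ->
  is_derive (fun s => c (Dbeta b g (mkP3 (x1 s) (x2 s) (x3 s)))) t
    (c (Dbeta (mi_incr 0 b) g (mkP3 (x1 t) (x2 t) (x3 t))) * l1
     + c (Dbeta (mi_incr 1 b) g (mkP3 (x1 t) (x2 t) (x3 t))) * l2
     + c (Dbeta (mi_incr 2 b) g (mkP3 (x1 t) (x2 t) (x3 t))) * l3).
Proof.
  intros Hb Hx X1 X2 X3.
  apply (is_derive_comp_curve U (fun y => c (Dbeta b g y))
           (fun y => c (Dbeta (mi_incr 0 b) g y)) (fun y => c (Dbeta (mi_incr 1 b) g y))
           (fun y => c (Dbeta (mi_incr 2 b) g y))); auto.
  1-3: apply Dbeta_pd; auto.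
  all: apply Dbeta_cont3; rewrite mi_abs_incr; lia.
Qed.

End DerivativesOfCk.

(** * Derivatives along the coordinate curves of the sphere *)

Lemma Cmod_scale (z : C) (r : R) : Cmod (fst z * r, snd z * r) = Cmod z * Rabs r.
Proof.
  rewrite <- Cmod_R, <- Cmod_mult; f_equal.
  unfold Cmult, RtoC; simpl; f_equal; ring.
Qed.

Lemma diff_chain_0 (h : R) (m : nat) : diff_chain h m 0 (fun _ => 0) (fun _ => 0).
Proof.
  induction m as [|m IH]; simpl.
  - split; [| split]; intros t; try apply continuous_const.
    rewrite Rminus_diag; apply Req_le, Cmod_0.
  - exists (fun _ => 0), (fun _ => 0); split; [| split]; auto; intros t;
      apply (is_derive_const (K := R_AbsRing) (V := R_NormedModule)).
Qed.

Definition sum_over {T : Type} (F : T -> R) (L : list T) : R :=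
  fold_right (fun x acc => F x + acc) 0 L.

Lemma diff_chain_sum_over {T : Type} (h : R) (m : nat) (K : R) (a b : T -> R -> R) (L : list T) :
  (forall x, In x L -> diff_chain h m K (a x) (b x)) ->
  diff_chain h m (INR (length L) * K) (fun t => sum_over (fun x => a x t) L)
    (fun t => sum_over (fun x => b x t) L).
Proof.
  induction L as [|x L IH]; intros H.
  - simpl length; rewrite Rmult_0_l; apply diff_chain_0.
  - simpl length; rewrite S_INR.
    replace ((INR (length L) + 1) * K) with (K + INR (length L) * K) by ring.
    apply diff_chain_plus; [apply H; now left | apply IH; intros; apply H; now right].
Qed.

(** A wave is stored as amplitude and phase. Differentiation adds a quarter turn and keeps the
    amplitude, so bounds by 1 persist at every order. *)
Definition wave (w : R * R) (t : R) : R := fst w * cos (t + snd w).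
Definition wave_deriv (w : R * R) : R * R := (fst w, snd w + PI / 2).
Definition wave_prod (ws : list (R * R)) (t : R) : R :=
  fold_right (fun w acc => wave w t * acc) 1 ws.

Lemma is_derive_wave (w : R * R) (t : R) : is_derive (wave w) t (wave (wave_deriv w) t).
Proof.
  unfold wave, wave_deriv; simpl.
  rewrite <- Rplus_assoc, cos_plus, cos_PI2, sin_PI2.
  auto_derive; [auto | ring].
Qed.

Lemma cos_lipschitz (x y : R) : Rabs (cos y - cos x) <= Rabs (y - x).
Proof.
  rewrite <- (Rmult_1_l (Rabs (y - x))).
  apply (bounded_variation cos (fun t => - sin t)); intros t _; split.
  - auto_derive; [auto | ring].
  - generalize (SIN_bound t); intros H; apply Rabs_le; lra.
Qed.

Lemma wave_bound (w : R * R) (t : R) : Rabs (fst w) <= 1 -> Rabs (wave w t) <= 1.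
Proof.
  intros Hw; unfold wave; rewrite Rabs_mult, <- (Rmult_1_l 1).
  apply Rmult_le_compat; auto using Rabs_pos.
  generalize (COS_bound (t + snd w)); intros H; apply Rabs_le; lra.
Qed.

Lemma wave_lipschitz (w : R * R) (s t : R) :
  Rabs (fst w) <= 1 -> Rabs (wave w s - wave w t) <= Rabs (s - t).
Proof.
  intros Hw; unfold wave; rewrite <- Rmult_minus_distr_l, Rabs_mult.
  rewrite <- (Rmult_1_l (Rabs (s - t))).
  apply Rmult_le_compat; auto using Rabs_pos.
  eapply Rle_trans; [apply cos_lipschitz |]; right; f_equal; ring.
Qed.

Lemma wave_periodic (w : R * R) (t : R) : wave w (t + 2 * PI) = wave w t.
Proof.
  unfold wave; f_equal; rewrite <- (cos_period (t + snd w) 1); f_equal; simpl; ring.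
Qed.

Lemma wave_prod_bound (ws : list (R * R)) (t : R) :
  List.Forall (fun w => Rabs (fst w) <= 1) ws -> Rabs (wave_prod ws t) <= 1.
Proof.
  induction 1 as [|w ws Hw _ IH]; simpl.
  - rewrite Rabs_R1; lra.
  - rewrite Rabs_mult, <- (Rmult_1_l 1).
    apply Rmult_le_compat; auto using Rabs_pos, wave_bound.
Qed.

Lemma wave_prod_lipschitz (ws : list (R * R)) (s t : R) :
  List.Forall (fun w => Rabs (fst w) <= 1) ws ->
  Rabs (wave_prod ws s - wave_prod ws t) <= INR (length ws) * Rabs (s - t).
Proof.
  induction 1 as [|w ws Hw Hws IH].
  - simpl; rewrite Rminus_diag, Rabs_R0; lra.
  - simpl length; rewrite S_INR.
    change (wave_prod (w :: ws)) with (fun x => wave w x * wave_prod ws x); cbv beta.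
    replace (wave w s * wave_prod ws s - wave w t * wave_prod ws t) with
      ((wave w s - wave w t) * wave_prod ws s + wave w t * (wave_prod ws s - wave_prod ws t))
      by ring.
    eapply Rle_trans; [apply Rabs_triang |]; rewrite !Rabs_mult.
    assert (H1 := wave_lipschitz w s t Hw); assert (H2 := wave_bound w t Hw).
    assert (H3 := wave_prod_bound ws s Hws).
    generalize (Rabs_pos (wave w s - wave w t)) (Rabs_pos (wave w t))
      (Rabs_pos (wave_prod ws s)) (Rabs_pos (wave_prod ws s - wave_prod ws t)); intros; nra.
Qed.

(** For |h| < 1 the Lipschitz bound applies. For |h| >= 1 the trivial bound 2 does: an empty product
    has no increment, and a nonempty one has length + 1 >= 2, which accounts for the extra 1. *)
Lemma wave_prod_difference (ws : list (R * R)) (t h W : R) :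
  List.Forall (fun w => Rabs (fst w) <= 1) ws -> Rmin 1 (Rabs h) <= W ->
  Rabs (wave_prod ws (t + h) - wave_prod ws t) <= INR (length ws + 1) * W.
Proof.
  intros Hws HW; rewrite plus_INR; simpl INR.
  assert (Hl := wave_prod_lipschitz ws (t + h) t Hws).
  replace (t + h - t) with h in Hl by ring.
  assert (HL := pos_INR (length ws)).
  revert HW; unfold Rmin; destruct (Rle_dec 1 (Rabs h)) as [H1 | H1]; intros HW.
  - destruct ws as [|w ws].
    + simpl in *; lra.
    + eapply Rle_trans; [apply Rabs_triang |]; rewrite Rabs_Ropp.
      assert (B1 := wave_prod_bound _ (t + h) Hws); assert (B2 := wave_prod_bound _ t Hws).
      simpl length; rewrite S_INR; generalize (pos_INR (length ws)); nra.
  - generalize (Rabs_pos h); nra.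
Qed.

Fixpoint wave_prod_derivs (ws : list (R * R)) : list (list (R * R)) :=
  match ws with
  | nil => nil
  | w :: ws => (wave_deriv w :: ws) :: map (cons w) (wave_prod_derivs ws)
  end.

Lemma length_wave_prod_derivs (ws : list (R * R)) :
  length (wave_prod_derivs ws) = length ws.
Proof. induction ws as [|w ws IH]; simpl; [| rewrite length_map, IH]; reflexivity. Qed.

Lemma wave_prod_derivs_spec (ws ws' : list (R * R)) :
  List.Forall (fun w => Rabs (fst w) <= 1) ws -> In ws' (wave_prod_derivs ws) ->
  length ws' = length ws /\ List.Forall (fun w => Rabs (fst w) <= 1) ws'.
Proof.
  intros Hws; revert ws'; induction Hws as [|w ws Hw Hws IH]; intros ws'; simpl.
  - tauto.
  - intros [<- | Hin].
    + split; [reflexivity | constructor; auto].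
    + apply in_map_iff in Hin; destruct Hin as (l & <- & Hl).
      destruct (IH l Hl) as [E HF]; simpl; auto.
Qed.

Lemma sum_over_map {S T : Type} (F : T -> R) (f : S -> T) (L : list S) :
  sum_over F (map f L) = sum_over (fun x => F (f x)) L.
Proof. induction L as [|x L IH]; simpl; [| rewrite IH]; reflexivity. Qed.

Lemma sum_over_scal {T : Type} (F : T -> R) (r : R) (L : list T) :
  sum_over (fun x => r * F x) L = r * sum_over F L.
Proof. induction L as [|x L IH]; simpl; [ring | rewrite IH; ring]. Qed.

Lemma is_derive_wave_prod (ws : list (R * R)) (t : R) :
  is_derive (wave_prod ws) t (sum_over (fun l => wave_prod l t) (wave_prod_derivs ws)).
Proof.
  induction ws as [|w ws IH]; simpl.
  - apply (is_derive_const (K := R_AbsRing) (V := R_NormedModule)).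
  - rewrite sum_over_map; simpl.
    rewrite (sum_over_scal (fun l => wave_prod l t) (wave w t)).
    apply (is_derive_mult (wave w) (wave_prod ws) t); auto using is_derive_wave.
    intros; apply Rmult_comm.
Qed.

(** Meridians and parallels both have this form; the offsets carry the constant height of a
    parallel. *)
Definition wave_curve (w1 w2 w3 : R * R) (d1 d2 d3 t : R) : P3 :=
  mkP3 (wave w1 t + d1) (wave w2 t + d2) (wave w3 t + d3).

Section TermsAlongCurve.

Variables (U : P3 -> Prop) (k : nat) (g : P3 -> C).
Variables (w1 w2 w3 : R * R) (d1 d2 d3 h W N : R).
Hypothesis HU : open3 U.
Hypothesis Hg : Ck U k g.
Hypotheses (Hw1 : Rabs (fst w1) <= 1) (Hw2 : Rabs (fst w2) <= 1) (Hw3 : Rabs (fst w3) <= 1).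

Local Notation curve := (wave_curve w1 w2 w3 d1 d2 d3).

Hypothesis Hcurve : forall t, U (curve t).
(** The scale [W] is |h|^alpha in the Hölder case, and |h| for alpha = 1, where [N] is a norm of
    order k + 1. The 3 in [Hdiff] covers both the three terms of the chain rule and the speed bound
    3 of the curve. *)
Hypothesis HW : Rmin 1 (Rabs h) <= W.
Hypothesis HN : forall b t, (mi_abs b <= k)%nat -> Cmod (Dbeta b g (curve t)) <= N.
Hypothesis Hdiff : forall b t, (mi_abs b <= k)%nat ->
  Cmod (Cminus (Dbeta b g (curve (t + h))) (Dbeta b g (curve t))) <= 3 * N * W.

Definition curve_term (c : C -> R) (T : mi * list (R * R)) (t : R) : R :=
  c (Dbeta (fst T) g (curve t)) * wave_prod (snd T) t.

Definition curve_term_derivs (T : mi * list (R * R)) : list (mi * list (R * R)) :=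
  (mi_incr 0 (fst T), wave_deriv w1 :: snd T) ::
  (mi_incr 1 (fst T), wave_deriv w2 :: snd T) ::
  (mi_incr 2 (fst T), wave_deriv w3 :: snd T) ::
  map (pair (fst T)) (wave_prod_derivs (snd T)).

Lemma is_derive_wave_shift (w : R * R) (d t : R) :
  is_derive (fun s => wave w s + d) t (wave (wave_deriv w) t).
Proof.
  replace (wave (wave_deriv w) t) with (plus (wave (wave_deriv w) t) 0) by apply Rplus_0_r.
  apply (is_derive_plus (wave w) (fun _ => d)).
  - apply is_derive_wave.
  - apply (is_derive_const (K := R_AbsRing) (V := R_NormedModule)).
Qed.

Lemma is_derive_term (c : C -> R) (T : mi * list (R * R)) (t : R) :
  c = fst \/ c = snd -> (mi_abs (fst T) < k)%nat ->
  is_derive (curve_term c T) t (sum_over (fun T' => curve_term c T' t) (curve_term_derivs T)).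
Proof.
  intros Hc HT; destruct T as [b ws]; simpl in HT.
  assert (Hd := is_derive_Dbeta_curve U k g c HU Hg Hc b
    (fun t => wave w1 t + d1) (fun t => wave w2 t + d2) (fun t => wave w3 t + d3) t _ _ _
    HT (Hcurve t) (is_derive_wave_shift w1 d1 t) (is_derive_wave_shift w2 d2 t)
    (is_derive_wave_shift w3 d3 t)).
  assert (Hm := is_derive_mult _ _ t _ _ Hd (is_derive_wave_prod ws t) Rmult_comm).
  unfold curve_term; simpl; rewrite sum_over_map; simpl.
  rewrite (sum_over_scal (fun l => wave_prod l t) (c (Dbeta b g (curve t)))).
  match goal with |- is_derive _ _ ?l => match type of Hm with is_derive _ _ ?l' =>
    replace l with l' end end; [exact Hm |].
  unfold wave_curve, plus, mult; simpl; unfold mult; simpl; ring.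
Qed.

(** At order [k] no further derivative of D^b g is available, so continuity comes from the uniform
    continuity of D^b g on [U]. *)
Lemma continuous_term (c : C -> R) (T : mi * list (R * R)) (t : R) :
  c = fst \/ c = snd -> (mi_abs (fst T) <= k)%nat -> continuous (curve_term c T) t.
Proof.
  intros Hc HT; unfold curve_term.
  apply (continuous_mult (K := R_AbsRing) (fun t => c (Dbeta (fst T) g (curve t)))).
  2:{ apply (ex_derive_continuous (V := R_NormedModule)); eexists; apply is_derive_wave_prod. }
  apply continuity_pt_filterlim; intros eps He.
  destruct (Dbeta_cont3 U k g c HU Hg Hc _ HT _ (Hcurve t) eps He) as (d & Hd & H).
  exists d; split; auto; intros s [_ Hs]; simpl in Hs; unfold R_dist in Hs.
  apply H; repeat split; simpl;
    match goal with |- Rabs (?x + ?d - (?y + ?d)) < _ =>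
      replace (x + d - (y + d)) with (x - y) by ring end;
    (eapply Rle_lt_trans; [apply wave_lipschitz |]; eassumption).
Qed.

(** The quotient of factorials is (j + 3) (j + 4) ... (j + m + 2) with j the number of waves: it
    bounds the number of summands after m derivatives, as a step multiplies by j + 3 and raises j by
    at most one. The number of waves equals the order of D^b g because the chain rule raises both by
    one and the Leibniz rule raises neither. *)
Lemma diff_chain_term (m : nat) (b : mi) (ws : list (R * R)) :
  (mi_abs b + m <= k)%nat -> length ws = mi_abs b ->
  List.Forall (fun w => Rabs (fst w) <= 1) ws ->
  diff_chain h m (INR (k + 4) * N * W * (INR (fact (length ws + m + 2)) / INR (fact (length ws + 2))))
    (curve_term fst (b, ws)) (curve_term snd (b, ws)).
Proof.
  assert (HW0 : 0 <= W).
  { eapply Rle_trans; [| exact HW]; apply Rmin_glb; [lra | apply Rabs_pos]. }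
  assert (HN0 : 0 <= N).
  { eapply Rle_trans; [apply Cmod_ge_0 | apply (HN (0, 0, 0)%nat 0); simpl; lia]. }
  assert (HNW : 0 <= N * W) by (now apply Rmult_le_pos).
  revert b ws; induction m as [|m IH]; intros b ws Hb Hl Hws.
  - split; [| split]; try (intros t; apply continuous_term; [auto | simpl; lia]).
    intros t; replace (length ws + 0 + 2)%nat with (length ws + 2)%nat by lia.
    unfold Rdiv; rewrite Rinv_r, Rmult_1_r by apply INR_fact_neq_0.
    set (F' := Dbeta b g (curve (t + h))); set (F := Dbeta b g (curve t)).
    set (p' := wave_prod ws (t + h)); set (p := wave_prod ws t).
    assert (E : (curve_term fst (b, ws) (t + h) - curve_term fst (b, ws) t,
                 curve_term snd (b, ws) (t + h) - curve_term snd (b, ws) t)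
              = Cplus (fst (Cminus F' F) * p', snd (Cminus F' F) * p')
                  (fst F * (p' - p), snd F * (p' - p))).
    { unfold curve_term, Cplus, Cminus, Copp; simpl; fold F F' p p'; f_equal; ring. }
    rewrite E; eapply Rle_trans; [apply Cmod_triangle |].
    rewrite !Cmod_scale.
    assert (B1 : Cmod (Cminus F' F) <= 3 * N * W) by (apply Hdiff; lia).
    assert (B2 : Cmod F <= N) by (apply HN; lia).
    assert (B3 : Rabs p' <= 1) by (now apply wave_prod_bound).
    assert (B4 : Rabs (p' - p) <= INR (length ws + 1) * W) by (now apply wave_prod_difference).
    assert (B5 : INR (length ws + 1) <= INR (k + 1)) by (apply le_INR; lia).
    (* The product rule for increments: 3 N W from D^b g, and N times (j + 1) W from the waves with
       j = |b| <= k, together (k + 4) N W. *)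
    apply Rle_trans with (3 * N * W * 1 + N * (INR (k + 1) * W)).
    + apply Rplus_le_compat; apply Rmult_le_compat; auto using Rabs_pos, Cmod_ge_0.
      eapply Rle_trans; [exact B4 |]; now apply Rmult_le_compat_r.
    + rewrite !plus_INR; simpl; lra.
  - exists (fun t => sum_over (fun T => curve_term fst T t) (curve_term_derivs (b, ws))),
           (fun t => sum_over (fun T => curve_term snd T t) (curve_term_derivs (b, ws))).
    split; [| split]; try (intros t; apply is_derive_term; [auto | simpl; lia]).
    (* [K] is the bound for j + 1 waves and m derivatives; j + 3 copies of it make up the bound for
       j waves and m + 1 derivatives, since (j + 3) (j + 2)! = (j + 3)!. *)
    set (K := INR (k + 4) * N * W
              * (INR (fact (S (length ws) + m + 2)) / INR (fact (S (length ws) + 2)))).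
    apply diff_chain_le with (INR (length (curve_term_derivs (b, ws))) * K).
    { simpl length; rewrite length_map, length_wave_prod_derivs.
      right; unfold K.
      replace (length ws + S m + 2)%nat with (S (length ws) + m + 2)%nat by lia.
      replace (fact (S (length ws) + 2)) with (S (S (S (length ws))) * fact (length ws + 2))%nat.
      2:{ replace (S (length ws) + 2)%nat with (S (length ws + 2)) by lia.
          rewrite fact_simpl; f_equal; lia. }
      rewrite mult_INR; field; split; [apply INR_fact_neq_0 | apply not_0_INR; lia]. }
    apply diff_chain_sum_over; intros [b' ws'] Hin.
    assert (Hnew : forall i w, Rabs (fst w) <= 1 ->
              diff_chain h m K (curve_term fst (mi_incr i b, wave_deriv w :: ws))
                (curve_term snd (mi_incr i b, wave_deriv w :: ws))).
    { intros i w Hw; apply (IH (mi_incr i b) (wave_deriv w :: ws)).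
      - rewrite mi_abs_incr; lia.
      - rewrite mi_abs_incr; simpl; lia.
      - constructor; auto. }
    destruct Hin as [[= <- <-] | [[= <- <-] | [[= <- <-] | Hin]]]; auto.
    apply in_map_iff in Hin; destruct Hin as (l & [= <- <-] & Hl').
    destruct (wave_prod_derivs_spec ws l Hws Hl') as [El HFl].
    (* A Leibniz term still has j waves, so its bound is smaller than [K] by the factor (j + 3) / (j
       + m + 3). *)
    eapply diff_chain_le; [| apply IH; auto; lia].
    rewrite El; unfold K; apply Rmult_le_compat_l.
    { rewrite Rmult_assoc; apply Rmult_le_pos; [apply pos_INR | exact HNW]. }
    replace (S (length ws) + m + 2)%nat with (S (length ws + m + 2)) by lia.
    replace (S (length ws) + 2)%nat with (S (length ws + 2)) by lia.
    rewrite !fact_simpl, !mult_INR.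
    assert (P1 := INR_fact_lt_0 (length ws + m + 2)).
    assert (P2 := INR_fact_lt_0 (length ws + 2)).
    assert (P3 : 0 < INR (S (length ws + 2))) by (apply lt_0_INR; lia).
    assert (P4 : INR (S (length ws + 2)) <= INR (S (length ws + m + 2))) by (apply le_INR; lia).
    set (u := INR (S (length ws + m + 2))) in *; set (v := INR (S (length ws + 2))) in *.
    set (x := INR (fact (length ws + m + 2))) in *; set (y := INR (fact (length ws + 2))) in *.
    apply Rmult_le_reg_r with (v * y); [now apply Rmult_lt_0_compat |].
    replace (u * x / (v * y) * (v * y)) with (u * x) by (field; lra).
    replace (x / y * (v * y)) with (v * x) by (field; lra).
    apply Rmult_le_compat_r; lra.
Qed.

Lemma diff_chain_curve :
  diff_chain h k (INR (fact (k + 3)) * N * W)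
    (fun t => fst (g (curve t))) (fun t => snd (g (curve t))).
Proof.
  assert (HW0 : 0 <= W).
  { eapply Rle_trans; [| exact HW]; apply Rmin_glb; [lra | apply Rabs_pos]. }
  assert (HN0 : 0 <= N).
  { eapply Rle_trans; [apply Cmod_ge_0 | apply (HN (0, 0, 0)%nat 0); simpl; lia]. }
  eapply diff_chain_ext; [| | eapply diff_chain_le;
    [| apply (diff_chain_term k (0, 0, 0)%nat nil); [simpl; lia | reflexivity | constructor]]].
  - intros t; unfold curve_term; simpl; apply Rmult_1_r.
  - intros t; unfold curve_term; simpl; apply Rmult_1_r.
  - cbn [length Nat.add]; replace (k + 3)%nat with (S (k + 2)) by lia.
    rewrite (fact_simpl (k + 2)), (mult_INR (S (k + 2))), S_INR, !plus_INR.
    simpl (fact 2); simpl INR.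
    assert (HNW : 0 <= N * W) by (now apply Rmult_le_pos).
    assert (P := INR_fact_lt_0 (k + 2)); assert (Pk := pos_INR k).
    set (x := INR (fact (k + 2))) in *.
    assert (HX : 0 <= N * W * x) by (apply Rmult_le_pos; lra).
    apply Rle_trans with ((INR k + 4) / 2 * (N * W * x)); [right; field |].
    (* Here (k + 4) / 2 <= k + 3 rounds the constant up to the factorial (k + 3)!. *)
    apply Rle_trans with ((INR k + 3) * (N * W * x)); [apply Rmult_le_compat_r; lra |].
    right; ring.
Qed.

End TermsAlongCurve.

(** * Bounds by the norm of an extension *)

(** [real] sends an infinite supremum to 0, so the upper bound [M] is what makes the conclusion
    hold. *)
Lemma le_real_Lub_Rbar (E : R -> Prop) (M v : R) :
  (forall w, E w -> w <= M) -> E v -> v <= real (Lub_Rbar E).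
Proof.
  intros HM Hv; destruct (Lub_Rbar_correct E) as [Hub Hlub].
  assert (H1 := Hub v Hv); assert (H2 := Hlub (Finite M) HM).
  destruct (Lub_Rbar E); simpl in *; tauto.
Qed.

Lemma le_real_Glb_Rbar (E : R -> Prop) (m v : R) :
  (forall w, E w -> m <= w) -> E v -> m <= real (Glb_Rbar E).
Proof.
  intros Hm Hv; destruct (Glb_Rbar_correct E) as [Hlb Hglb].
  assert (H1 := Hlb v Hv); assert (H2 := Hglb (Finite m) Hm).
  destruct (Glb_Rbar E); simpl in *; tauto.
Qed.

Lemma In_Bk (k : nat) (b : mi) : (mi_abs b <= k)%nat -> In b (Bk k).
Proof.
  destruct b as [[b1 b2] b3]; unfold mi_abs, Bk; intros Hb.
  apply in_flat_map; exists b1; split; [apply in_seq; lia |].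
  apply in_flat_map; exists b2; split; [apply in_seq; lia |].
  apply in_map_iff; exists b3; split; [reflexivity | apply in_seq; lia].
Qed.

Lemma fold_right_Rplus_nonneg (L : list R) :
  (forall x, In x L -> 0 <= x) -> 0 <= fold_right Rplus 0 L.
Proof.
  induction L as [|x L IH]; simpl; intros H; [lra |].
  apply Rplus_le_le_0_compat; [apply H; now left | apply IH; intros; apply H; now right].
Qed.

Lemma fold_right_Rplus_In (L : list R) (x : R) :
  (forall x, In x L -> 0 <= x) -> In x L -> x <= fold_right Rplus 0 L.
Proof.
  induction L as [|y L IH]; simpl; intros H Hin; [tauto |].
  assert (Hy : 0 <= y) by (apply H; now left).
  assert (HL : 0 <= fold_right Rplus 0 L)
    by (apply fold_right_Rplus_nonneg; intros; apply H; now right).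
  destruct Hin as [-> | Hin]; [lra |].
  assert (x <= fold_right Rplus 0 L) by (apply IH; auto); lra.
Qed.

(** Either the supremum is finite and dominates the modulus at one point, or it is infinite and
    [real] returns 0; no boundedness is assumed. *)
Lemma sup_S2_nonneg (b : mi) (g : P3 -> C) : 0 <= sup_S2 b g.
Proof.
  unfold sup_S2; set (E := fun v => _).
  assert (He : E (Cmod (Dbeta b g (mkP3 1 0 0)))).
  { exists (mkP3 1 0 0); split; [unfold S2; simpl; ring | reflexivity]. }
  assert (H := proj1 (Lub_Rbar_correct E) _ He).
  assert (H0 := Cmod_ge_0 (Dbeta b g (mkP3 1 0 0))).
  destruct (Lub_Rbar E); simpl in *; lra.
Qed.

Lemma enorm3_sub3_pos (x y : P3) : x <> y -> 0 < enorm3 (sub3 x y).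
Proof.
  intros Hxy; apply sqrt_lt_R0.
  destruct x as [x1 x2 x3], y as [y1 y2 y3]; unfold sub3; cbn [p1 p2 p3].
  assert (Hsq : forall u v, u <> v -> 0 < (u - v) ^ 2) by (intros; apply pow2_gt_0; lra).
  generalize (pow2_ge_0 (x1 - y1)) (pow2_ge_0 (x2 - y2)) (pow2_ge_0 (x3 - y3)); intros P1 P2 P3.
  destruct (Req_dec x1 y1) as [E1 | E1]; [| generalize (Hsq _ _ E1); lra].
  destruct (Req_dec x2 y2) as [E2 | E2]; [| generalize (Hsq _ _ E2); lra].
  destruct (Req_dec x3 y3) as [E3 | E3]; [| generalize (Hsq _ _ E3); lra].
  congruence.
Qed.

Lemma holder_S2_nonneg (k : nat) (alpha : R) (g : P3 -> C) : 0 <= holder_S2 k alpha g.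
Proof.
  unfold holder_S2; set (E := fun v => _).
  set (x := mkP3 1 0 0); set (y := mkP3 (-1) 0 0).
  set (v := Cmod (Cminus (Dbeta (k, 0, 0)%nat g x) (Dbeta (k, 0, 0)%nat g y))
            / Rpower (enorm3 (sub3 x y)) alpha).
  assert (He : E v).
  { exists (k, 0, 0)%nat, x, y; split; [simpl; lia |].
    split; [| split; [| split]]; try (unfold S2; simpl; ring); [| reflexivity].
    unfold x, y; intros [= H]; lra. }
  assert (H := proj1 (Lub_Rbar_correct E) _ He).
  assert (H0 : 0 <= v).
  { apply Rmult_le_pos; [apply Cmod_ge_0 |].
    left; apply Rinv_0_lt_compat; apply exp_pos. }
  destruct (Lub_Rbar E); simpl in *; lra.
Qed.

Lemma ext_value_ge_sup (U : P3 -> Prop) (k : nat) (alpha : R) (g : P3 -> C) (b : mi) (xi : P3) :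
  (forall x, S2 x -> U x) -> Ck U k g -> (mi_abs b <= k)%nat -> S2 xi ->
  Cmod (Dbeta b g xi) <= ext_value k alpha g.
Proof.
  intros HU Hg Hb Hxi.
  apply Rle_trans with (sup_S2 b g).
  - destruct (Hg b Hb) as (_ & (M & HM) & _).
    apply le_real_Lub_Rbar with M.
    + intros w (x & Hx & ->); auto.
    + exists xi; auto.
  - unfold ext_value; rewrite <- (Rplus_0_r (sup_S2 b g)); apply Rplus_le_compat.
    + apply fold_right_Rplus_In.
      * intros x Hx; apply in_map_iff in Hx; destruct Hx as (b' & <- & _); apply sup_S2_nonneg.
      * apply (in_map (fun b => sup_S2 b g)), In_Bk, Hb.
    + destruct (Rlt_dec 0 alpha); [apply holder_S2_nonneg | lra].
Qed.

Lemma ext_value_ge_holder (U : P3 -> Prop) (k : nat) (alpha : R) (g : P3 -> C) (b : mi)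
    (xi eta : P3) :
  (forall x, S2 x -> U x) -> Cka U k alpha g -> 0 < alpha -> mi_abs b = k ->
  S2 xi -> S2 eta -> xi <> eta ->
  Cmod (Cminus (Dbeta b g xi) (Dbeta b g eta))
  <= ext_value k alpha g * Rpower (enorm3 (sub3 xi eta)) alpha.
Proof.
  intros HU [Hg HH] Ha Hb Hxi Heta Hne; destruct (HH Ha) as [M HM].
  assert (Hp : forall x, 0 < Rpower x alpha) by (intros; apply exp_pos).
  assert (H : Cmod (Cminus (Dbeta b g xi) (Dbeta b g eta)) / Rpower (enorm3 (sub3 xi eta)) alpha
              <= holder_S2 k alpha g).
  { apply le_real_Lub_Rbar with M.
    - intros w (b' & x & y & Hb' & Hx & Hy & Hxy & ->).
      apply Rmult_le_reg_r with (Rpower (enorm3 (sub3 x y)) alpha); auto.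
      unfold Rdiv; rewrite Rmult_assoc, Rinv_l, Rmult_1_r by (apply Rgt_not_eq, Hp); auto.
    - exists b, xi, eta; tauto. }
  apply Rle_trans with (holder_S2 k alpha g * Rpower (enorm3 (sub3 xi eta)) alpha).
  - apply Rmult_le_reg_r with (/ Rpower (enorm3 (sub3 xi eta)) alpha);
      [apply Rinv_0_lt_compat; auto |].
    rewrite Rmult_assoc, Rinv_r, Rmult_1_r by (apply Rgt_not_eq, Hp); exact H.
  - apply Rmult_le_compat_r; [left; auto |].
    unfold ext_value; destruct (Rlt_dec 0 alpha) as [_ | n]; [| lra].
    rewrite <- (Rplus_0_l (holder_S2 k alpha g)) at 1; apply Rplus_le_compat_r.
    apply fold_right_Rplus_nonneg; intros x Hx.
    apply in_map_iff in Hx; destruct Hx as (b' & <- & _); apply sup_S2_nonneg.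
Qed.

(** For x >= 1 the power is at least 1, for x < 1 it is at least x. This absorbs Lipschitz and
    trivial bounds into |h|^alpha. *)
Lemma Rmin_1_le_Rpower (x alpha : R) : 0 < x -> 0 < alpha <= 1 -> Rmin 1 x <= Rpower x alpha.
Proof.
  intros Hx Ha; destruct (Rle_dec 1 x) as [H1 | H1].
  - eapply Rle_trans; [apply Rmin_l |]; rewrite <- (Rpower_O x) by auto.
    apply Rle_Rpower; lra.
  - eapply Rle_trans; [apply Rmin_r |].
    assert (Hln : ln x < 0) by (rewrite <- ln_1; apply ln_increasing; lra).
    rewrite <- (Rpower_1 x) at 1 by auto; unfold Rpower.
    destruct (Rle_lt_or_eq_dec (1 * ln x) (alpha * ln x)) as [H | ->]; [nra | | lra].
    left; now apply exp_increasing.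
Qed.

Lemma wave_curve_enorm3 (w1 w2 w3 : R * R) (d1 d2 d3 s t : R) :
  Rabs (fst w1) <= 1 -> Rabs (fst w2) <= 1 -> Rabs (fst w3) <= 1 ->
  enorm3 (sub3 (wave_curve w1 w2 w3 d1 d2 d3 s) (wave_curve w1 w2 w3 d1 d2 d3 t))
  <= 3 * Rabs (s - t).
Proof.
  intros H1 H2 H3; eapply Rle_trans; [apply enorm3_le_sum |]; simpl.
  replace (wave w1 s + d1 - (wave w1 t + d1)) with (wave w1 s - wave w1 t) by ring.
  replace (wave w2 s + d2 - (wave w2 t + d2)) with (wave w2 s - wave w2 t) by ring.
  replace (wave w3 s + d3 - (wave w3 t + d3)) with (wave w3 s - wave w3 t) by ring.
  assert (A1 := wave_lipschitz w1 s t H1); assert (A2 := wave_lipschitz w2 s t H2).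
  assert (A3 := wave_lipschitz w3 s t H3); lra.
Qed.

(** The mean value inequality is applied to the real projection of D^b g onto the direction of the
    increment. Its derivative has three terms, each a derivative bounded by [N] times a wave bounded
    by 1. *)
Lemma Dbeta_curve_lipschitz (U : P3 -> Prop) (K : nat) (g : P3 -> C) (N : R) (b : mi)
    (w1 w2 w3 : R * R) (d1 d2 d3 s t : R) :
  open3 U -> Ck U K g -> (forall t, U (wave_curve w1 w2 w3 d1 d2 d3 t)) ->
  Rabs (fst w1) <= 1 -> Rabs (fst w2) <= 1 -> Rabs (fst w3) <= 1 ->
  (forall b t, (mi_abs b <= K)%nat -> Cmod (Dbeta b g (wave_curve w1 w2 w3 d1 d2 d3 t)) <= N) ->
  (mi_abs b < K)%nat ->
  Cmod (Cminus (Dbeta b g (wave_curve w1 w2 w3 d1 d2 d3 s))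
               (Dbeta b g (wave_curve w1 w2 w3 d1 d2 d3 t))) <= 3 * N * Rabs (s - t).
Proof.
  intros HU Hg HC H1 H2 H3 HN Hb.
  set (F := fun t => Dbeta b g (wave_curve w1 w2 w3 d1 d2 d3 t)).
  set (G := fun i t => Dbeta (mi_incr i b) g (wave_curve w1 w2 w3 d1 d2 d3 t)).
  change (Cmod (Cminus (F s) (F t)) <= 3 * N * Rabs (s - t)).
  destruct (Cmod_polar (Cminus (F s) (F t))) as [psi Hpsi].
  set (p := fun z : C => fst z * cos psi + snd z * sin psi).
  replace (Cmod (Cminus (F s) (F t))) with (p (F s) - p (F t)).
  2:{ rewrite Hpsi; unfold p, Cminus, Cplus, Copp; simpl; ring. }
  eapply Rle_trans; [apply Rle_abs |].
  set (dw := fun w t => wave (wave_deriv w) t).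
  apply (bounded_variation (fun t => p (F t))
    (fun t => p (G 0%nat t) * dw w1 t + p (G 1%nat t) * dw w2 t + p (G 2%nat t) * dw w3 t)).
  intros u _; split.
  - assert (Hd : forall c, c = fst \/ c = snd -> is_derive (fun t => c (F t)) u
      (c (G 0%nat u) * dw w1 u + c (G 1%nat u) * dw w2 u + c (G 2%nat u) * dw w3 u)).
    { intros c Hc; apply (is_derive_Dbeta_curve U K g c HU Hg Hc b
        (fun t => wave w1 t + d1) (fun t => wave w2 t + d2) (fun t => wave w3 t + d3)); auto;
        try apply is_derive_wave_shift; apply HC. }
    assert (H := is_derive_plus _ _ _ _ _
      (is_derive_scal_l (V := R_NormedModule) _ _ _ (cos psi) (Hd fst (or_introl eq_refl)))
      (is_derive_scal_l (V := R_NormedModule) _ _ _ (sin psi) (Hd snd (or_intror eq_refl)))).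
    match goal with |- is_derive _ _ ?l => match type of H with is_derive _ _ ?l' =>
      replace l with l' end end; [exact H |].
    unfold p, plus, scal; simpl; unfold mult; simpl; ring.
  - assert (Hp : forall i w, Rabs (fst w) <= 1 -> Rabs (p (G i u) * dw w u) <= N).
    { intros i w Hw; rewrite Rabs_mult, <- (Rmult_1_r N).
      apply Rmult_le_compat; auto using Rabs_pos.
      - eapply Rle_trans; [apply cos_sin_le_Cmod |]; rewrite <- surjective_pairing.
        apply HN; rewrite mi_abs_incr; lia.
      - now apply wave_bound. }
    eapply Rle_trans; [apply Rabs_triang |].
    assert (A3 := Hp 2%nat w3 H3).
    assert (A12 := Rle_trans _ _ _ (Rabs_triang _ _)
      (Rplus_le_compat _ _ _ _ (Hp 0%nat w1 H1) (Hp 1%nat w2 H2))); lra.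
Qed.

Lemma Cmod_minus_le (z w : C) : Cmod (Cminus z w) <= Cmod z + Cmod w.
Proof. eapply Rle_trans; [apply Cmod_triangle |]; rewrite Cmod_opp; lra. Qed.

(* Below top order both bounds [2 N] and [3 N |h|] are available, which covers
   large and small shifts respectively. *)
Lemma diff_chain_holder (U : P3 -> Prop) (k : nat) (alpha : R) (g : P3 -> C)
    (w1 w2 w3 : R * R) (d1 d2 d3 h : R) :
  0 < alpha <= 1 -> h <> 0 -> open3 U -> (forall x, S2 x -> U x) -> Cka U k alpha g ->
  Rabs (fst w1) <= 1 -> Rabs (fst w2) <= 1 -> Rabs (fst w3) <= 1 ->
  (forall t, S2 (wave_curve w1 w2 w3 d1 d2 d3 t)) ->
  diff_chain h k (INR (fact (k + 3)) * ext_value k alpha g * Rpower (Rabs h) alpha)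
    (fun t => fst (g (wave_curve w1 w2 w3 d1 d2 d3 t)))
    (fun t => snd (g (wave_curve w1 w2 w3 d1 d2 d3 t))).
Proof.
  intros Ha Hh HU HS [Hg HH] H1 H2 H3 HC.
  assert (Hhp : 0 < Rabs h) by (now apply Rabs_pos_lt).
  assert (HW := Rmin_1_le_Rpower (Rabs h) alpha Hhp Ha).
  set (N := ext_value k alpha g) in *; set (W := Rpower (Rabs h) alpha) in *.
  assert (HN : forall b t, (mi_abs b <= k)%nat ->
            Cmod (Dbeta b g (wave_curve w1 w2 w3 d1 d2 d3 t)) <= N).
  { intros b t Hb; apply ext_value_ge_sup with U; auto. }
  assert (HN0 : 0 <= N).
  { eapply Rle_trans; [apply Cmod_ge_0 | apply (HN (0, 0, 0)%nat 0); simpl; lia]. }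
  assert (HW0 : 0 < W) by apply exp_pos.
  apply diff_chain_curve with U; auto.
  intros b t Hb; destruct (le_lt_eq_dec _ _ Hb) as [Hlt | Heq].
  - assert (HL := Dbeta_curve_lipschitz U k g N b w1 w2 w3 d1 d2 d3 (t + h) t HU Hg
      (fun t => HS _ (HC t)) H1 H2 H3 HN Hlt).
    replace (t + h - t) with h in HL by ring.
    revert HW; unfold Rmin; destruct (Rle_dec 1 (Rabs h)) as [Hl | Hl]; intros HW.
    + eapply Rle_trans; [apply Cmod_minus_le |].
      assert (E1 := HN b (t + h) Hb); assert (E2 := HN b t Hb); nra.
    + eapply Rle_trans; [exact HL |]; apply Rmult_le_compat_l; lra.
  - set (c := wave_curve w1 w2 w3 d1 d2 d3) in *.
    (* The Hölder quotient is formed at distinct points only, whereas the curve may return to the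
       same point after the step [h]. *)
    assert (Hdec : c (t + h) = c t \/ c (t + h) <> c t).
    { destruct (c (t + h)) as [x1 x2 x3], (c t) as [y1 y2 y3].
      destruct (Req_dec x1 y1) as [<- | E1]; [| right; congruence].
      destruct (Req_dec x2 y2) as [<- | E2]; [| right; congruence].
      destruct (Req_dec x3 y3) as [<- | E3]; [now left | right; congruence]. }
    destruct Hdec as [-> | Hne].
    + unfold Cminus; rewrite Cplus_opp_r, Cmod_0.
      repeat apply Rmult_le_pos; lra.
    + eapply Rle_trans; [apply (ext_value_ge_holder U k alpha g b); auto; [split; auto | lra] |].
      fold N; replace (3 * N * W) with (N * (3 * W)) by ring.
      apply Rmult_le_compat_l; auto.
      (* The points lie at distance at most 3 |h|, and 3^alpha <= 3. *)
      apply Rle_trans with (Rpower (3 * Rabs h) alpha).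
      * apply Rle_Rpower_l; [lra |]; split; [now apply enorm3_sub3_pos |].
        eapply Rle_trans; [apply wave_curve_enorm3; auto |].
        right; do 2 f_equal; ring.
      * rewrite <- Rpower_mult_distr by lra; apply Rmult_le_compat_r; [left; exact HW0 |].
        rewrite <- (Rpower_1 3) at 2 by lra; apply Rle_Rpower; lra.
Qed.

(** With one more bounded derivative, every D^b g of order at most [k] is Lipschitz along the curve,
    so the top order needs no separate treatment. *)
Lemma diff_chain_smooth (U : P3 -> Prop) (k : nat) (g : P3 -> C)
    (w1 w2 w3 : R * R) (d1 d2 d3 h : R) :
  h <> 0 -> open3 U -> (forall x, S2 x -> U x) -> Ck U (S k) g ->
  Rabs (fst w1) <= 1 -> Rabs (fst w2) <= 1 -> Rabs (fst w3) <= 1 ->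
  (forall t, S2 (wave_curve w1 w2 w3 d1 d2 d3 t)) ->
  diff_chain h k (INR (fact (k + 3)) * ext_value (S k) 0 g * Rpower (Rabs h) 1)
    (fun t => fst (g (wave_curve w1 w2 w3 d1 d2 d3 t)))
    (fun t => snd (g (wave_curve w1 w2 w3 d1 d2 d3 t))).
Proof.
  intros Hh HU HS Hg H1 H2 H3 HC.
  assert (Hhp : 0 < Rabs h) by (now apply Rabs_pos_lt).
  rewrite Rpower_1 by auto.
  assert (HN : forall b t, (mi_abs b <= S k)%nat ->
            Cmod (Dbeta b g (wave_curve w1 w2 w3 d1 d2 d3 t)) <= ext_value (S k) 0 g).
  { intros b t Hb; apply ext_value_ge_sup with U; auto. }
  apply diff_chain_curve with U; auto.
  - intros b Hb; apply Hg; lia.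
  - apply Rmin_r.
  - intros b t Hb.
    assert (HL := Dbeta_curve_lipschitz U (S k) g (ext_value (S k) 0 g) b w1 w2 w3 d1 d2 d3
      (t + h) t HU Hg (fun t => HS _ (HC t)) H1 H2 H3 HN).
    replace (t + h - t) with h in HL by ring; apply HL; lia.
Qed.

(** * Fourier coefficients of the DFS function *)

Lemma S2_phi (lam th : R) : S2 (phi lam th).
Proof.
  unfold S2, phi; cbn [p1 p2 p3].
  generalize (sin2_cos2 lam) (sin2_cos2 th); unfold Rsqr; intros H1 H2.
  replace ((cos lam * sin th) ^ 2 + (sin lam * sin th) ^ 2 + cos th ^ 2) with
    ((sin lam * sin lam + cos lam * cos lam) * (sin th * sin th) + cos th * cos th) by ring.
  rewrite H1; lra.
Qed.

Lemma cos_minus_PI2 (t : R) : cos (t + - (PI / 2)) = sin t.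
Proof. rewrite cos_plus, cos_neg, sin_neg, cos_PI2, sin_PI2; ring. Qed.

Lemma phi_meridian (lam th : R) :
  phi lam th = wave_curve (cos lam, - (PI / 2)) (sin lam, - (PI / 2)) (1, 0) 0 0 0 th.
Proof.
  unfold phi, wave_curve, wave; simpl; rewrite cos_minus_PI2, !Rplus_0_r; f_equal; ring.
Qed.

Lemma phi_parallel (lam th : R) :
  phi lam th = wave_curve (sin th, 0) (sin th, - (PI / 2)) (0, 0) 0 0 (cos th) lam.
Proof.
  unfold phi, wave_curve, wave; simpl; rewrite cos_minus_PI2, !Rplus_0_r; f_equal; ring.
Qed.

Lemma wave_curve_periodic (w1 w2 w3 : R * R) (d1 d2 d3 t : R) :
  wave_curve w1 w2 w3 d1 d2 d3 (t + 2 * PI) = wave_curve w1 w2 w3 d1 d2 d3 t.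
Proof. unfold wave_curve; now rewrite !wave_periodic. Qed.

Lemma continuity_2d_pt_phi (h : P3 -> R) (u v : R) :
  cont3 h (phi u v) -> continuity_2d_pt (fun u v => h (phi u v)) u v.
Proof.
  intros Hh eps; destruct (Hh eps (cond_pos eps)) as (d & Hd & H).
  assert (Hcos1 : continuity_2d_pt (fun u v => cos u) u v)
    by (apply (continuity_1d_2d_pt_comp cos); [apply continuity_cos | apply continuity_2d_pt_id1]).
  assert (Hsin1 : continuity_2d_pt (fun u v => sin u) u v)
    by (apply (continuity_1d_2d_pt_comp sin); [apply continuity_sin | apply continuity_2d_pt_id1]).
  assert (Hcos2 : continuity_2d_pt (fun u v => cos v) u v)
    by (apply (continuity_1d_2d_pt_comp cos); [apply continuity_cos | apply continuity_2d_pt_id2]).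
  assert (Hsin2 : continuity_2d_pt (fun u v => sin v) u v)
    by (apply (continuity_1d_2d_pt_comp sin); [apply continuity_sin | apply continuity_2d_pt_id2]).
  assert (K1 := continuity_2d_pt_mult _ _ _ _ Hcos1 Hsin2 (mkposreal d Hd)).
  assert (K2 := continuity_2d_pt_mult _ _ _ _ Hsin1 Hsin2 (mkposreal d Hd)).
  assert (K3 := Hcos2 (mkposreal d Hd)).
  eapply locally_2d_impl; [| exact (locally_2d_and _ _ _ _ K1 (locally_2d_and _ _ _ _ K2 K3))].
  apply locally_2d_forall; intros x y (B1 & B2 & B3); apply H; now repeat split.
Qed.

Lemma RInt2_linear (f1 f2 : R -> R -> R) (p q a b c d : R) :
  (forall u v, continuity_2d_pt f1 u v) -> (forall u v, continuity_2d_pt f2 u v) ->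
  RInt (fun x => RInt (fun y => p * f1 x y + q * f2 x y) c d) a b
  = p * RInt (fun x => RInt (f1 x) c d) a b + q * RInt (fun x => RInt (f2 x) c d) a b.
Proof.
  assert (Hlin : forall (g1 g2 : R -> R) x y, ex_RInt g1 x y -> ex_RInt g2 x y ->
    RInt (fun t => p * g1 t + q * g2 t) x y = p * RInt g1 x y + q * RInt g2 x y).
  { intros g1 g2 x y E1 E2.
    rewrite (RInt_plus (V := R_CompleteNormedModule) (fun t => p * g1 t) (fun t => q * g2 t)).
    - rewrite (RInt_scal (V := R_CompleteNormedModule) g1),
        (RInt_scal (V := R_CompleteNormedModule) g2); auto.
    - apply (ex_RInt_scal (V := R_NormedModule)); auto.
    - apply (ex_RInt_scal (V := R_NormedModule)); auto. }
  intros H1 H2.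
  rewrite (RInt_ext _ (fun x => p * RInt (f1 x) c d + q * RInt (f2 x) c d)).
  - apply Hlin; apply ex_RInt_continuous_everywhere; intros; now apply continuous_RInt_param.
  - intros x _; apply Hlin; apply ex_RInt_continuous_everywhere; intros t;
      now apply continuity_2d_pt_continuous_r.
Qed.

Lemma RInt2_bound (f : R -> R -> R) (M : R) :
  (forall u v, continuity_2d_pt f u v) ->
  (forall x, Rabs (RInt (f x) 0 (2 * PI)) <= M) ->
  Rabs (RInt (fun x => RInt (f x) 0 (2 * PI)) 0 (2 * PI)) <= 2 * PI * M.
Proof.
  intros Hf HM; replace (2 * PI * M) with ((2 * PI - 0) * M) by ring.
  apply abs_RInt_le_const; auto.
  - generalize PI_RGT_0; lra.
  - apply ex_RInt_continuous_everywhere; intros; now apply continuous_RInt_param.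
Qed.

(** The chain hypothesis hides which norm [N] is, so the Hölder case and alpha = 1 share the passage
    from curves to the torus. For each value of the other variable the one-dimensional decay applies
    uniformly. *)
Lemma fourier_coef_dfs_bound (U : P3 -> Prop) (k : nat) (alpha N : R) (f g : P3 -> C) (n1 n2 : Z) :
  open3 U -> (forall x, S2 x -> U x) -> Ck U 0 g -> (forall x, S2 x -> g x = f x) ->
  (forall w1 w2 w3 d1 d2 d3 h, h <> 0 ->
    Rabs (fst w1) <= 1 -> Rabs (fst w2) <= 1 -> Rabs (fst w3) <= 1 ->
    (forall t, S2 (wave_curve w1 w2 w3 d1 d2 d3 t)) ->
    diff_chain h k (INR (fact (k + 3)) * N * Rpower (Rabs h) alpha)
      (fun t => fst (g (wave_curve w1 w2 w3 d1 d2 d3 t)))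
      (fun t => snd (g (wave_curve w1 w2 w3 d1 d2 d3 t)))) ->
  forall n, n <> 0%Z -> n = n1 \/ n = n2 ->
  Cmod (fourier_coef (dfs f) n1 n2)
  <= / 2 * (INR (fact (k + 3)) * N * Rpower (Rabs (PI / IZR n)) alpha / Rabs (IZR n) ^ k).
Proof.
  intros HU HS Hg Hfg Hch n Hn Hn12.
  assert (HPI := PI_RGT_0).
  assert (Hh : PI / IZR n <> 0).
  { apply Rmult_integral_contrapositive_currified; [lra |].
    apply Rinv_neq_0_compat; now apply not_0_IZR. }
  assert (Htrig : forall s, -1 <= s <= 1 -> Rabs s <= 1) by (intros; apply Rabs_le; lra).
  assert (Hcont : forall (c : C -> R), c = fst \/ c = snd ->
            forall u v, continuity_2d_pt (fun u v => c (g (phi u v))) u v).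
  { intros c Hc u v; apply (continuity_2d_pt_phi (fun x => c (g x))).
    apply (Dbeta_cont3 U 0 g c HU Hg Hc (0, 0, 0)%nat); [simpl; lia |].
    apply HS, S2_phi. }
  set (a := fun u v => fst (g (phi u v))); set (b := fun u v => snd (g (phi u v))).
  assert (Ca : forall u v, continuity_2d_pt a u v) by (apply (Hcont fst); auto).
  assert (Cb : forall u v, continuity_2d_pt b u v) by (apply (Hcont snd); auto).
  set (ph := fun u v : R => IZR n1 * u + IZR n2 * v).
  assert (Cph : forall s u v, continuity_2d_pt (fun u v => ph u v + s) u v).
  { intros s u v; unfold ph.
    repeat apply continuity_2d_pt_plus; try apply continuity_2d_pt_mult;
      try apply continuity_2d_pt_const; [apply continuity_2d_pt_id1 | apply continuity_2d_pt_id2]. }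
  assert (Ccos : forall s u v, continuity_2d_pt (fun u v => cos (ph u v + s)) u v).
  { intros s u v; apply (continuity_1d_2d_pt_comp cos); [apply continuity_cos | apply Cph]. }
  assert (Csin : forall s u v, continuity_2d_pt (fun u v => sin (ph u v + s)) u v).
  { intros s u v; apply (continuity_1d_2d_pt_comp sin); [apply continuity_sin | apply Cph]. }
  (* The zero phase is spelled out so that the continuity facts for an arbitrary phase apply. *)
  set (re := fun u v => a u v * cos (ph u v + 0) + b u v * sin (ph u v + 0)).
  set (im := fun u v => b u v * cos (ph u v + 0) - a u v * sin (ph u v + 0)).
  assert (Cre : forall u v, continuity_2d_pt re u v).
  { intros u v; apply continuity_2d_pt_plus; apply continuity_2d_pt_mult; auto. }
  assert (Cim : forall u v, continuity_2d_pt im u v).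
  { intros u v; apply continuity_2d_pt_minus; apply continuity_2d_pt_mult; auto. }
  assert (Eint : forall u v, fst (fourier_integrand (dfs f) n1 n2 u v) = re u v /\
                             snd (fourier_integrand (dfs f) n1 n2 u v) = im u v).
  { intros u v; unfold re, im; rewrite Rplus_0_r.
    unfold fourier_integrand, dfs, a, b; rewrite (Hfg (phi u v)) by apply S2_phi.
    unfold ph; simpl; split; ring. }
  destruct (Cmod_polar (fourier_coef (dfs f) n1 n2)) as [psi ->].
  unfold fourier_coef; cbn [fst snd].
  rewrite (RInt_ext (fun x1 => RInt (fun x2 => fst (fourier_integrand (dfs f) n1 n2 x1 x2)) 0 (2 * PI))
             (fun x1 => RInt (re x1) 0 (2 * PI)))
    by (intros u _; apply RInt_ext; intros v _; apply Eint).
  rewrite (RInt_ext (fun x1 => RInt (fun x2 => snd (fourier_integrand (dfs f) n1 n2 x1 x2)) 0 (2 * PI))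
             (fun x1 => RInt (im x1) 0 (2 * PI)))
    by (intros u _; apply RInt_ext; intros v _; apply Eint).
  (* [P] is the real part of the Fourier integrand rotated by e^(-i psi), psi being an argument of
     the coefficient. *)
  set (P := fun u v => a u v * cos (ph u v + psi) + b u v * sin (ph u v + psi)).
  assert (CP : forall u v, continuity_2d_pt P u v).
  { intros u v; apply continuity_2d_pt_plus; apply continuity_2d_pt_mult; auto. }
  assert (EP : cos psi * RInt (fun x1 => RInt (re x1) 0 (2 * PI)) 0 (2 * PI)
               + sin psi * RInt (fun x1 => RInt (im x1) 0 (2 * PI)) 0 (2 * PI)
               = RInt (fun x1 => RInt (P x1) 0 (2 * PI)) 0 (2 * PI)).
  { rewrite <- RInt2_linear by auto.
    apply RInt_ext; intros u _; apply RInt_ext; intros v _.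
    change (cos psi * re u v + sin psi * im u v = P u v).
    unfold P, re, im; rewrite Rplus_0_r, cos_plus, sin_plus; ring. }
  set (K := INR (fact (k + 3)) * N * Rpower (Rabs (PI / IZR n)) alpha) in *.
  assert (HB : Rabs (RInt (fun x1 => RInt (P x1) 0 (2 * PI)) 0 (2 * PI))
               <= 2 * PI * (PI * K / Rabs (IZR n) ^ k)).
  { destruct Hn12 as [E | E].
    - rewrite RInt_exchange by auto.
      apply RInt2_bound.
      { intros u v; now apply (continuity_2d_pt_swap P). }
      intros v.
      rewrite (RInt_ext (fun u => P u v)
        (trig_pair (fun u => a u v) (fun u => b u v) (IZR n) (IZR n2 * v + psi))).
      2:{ intros u _; unfold P, ph, trig_pair; rewrite E, <- Rplus_assoc; reflexivity. }
      apply RInt_trig_pair_decay; auto.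
      + eapply diff_chain_ext; [| | apply (Hch (sin v, 0) (sin v, - (PI / 2)) (0, 0) 0 0 (cos v))].
        * intros u; unfold a; now rewrite phi_parallel.
        * intros u; unfold b; now rewrite phi_parallel.
        * exact Hh.
        * apply Htrig, SIN_bound.
        * apply Htrig, SIN_bound.
        * apply Htrig; simpl; lra.
        * intros t; rewrite <- phi_parallel; apply S2_phi.
      + intros u; unfold a; now rewrite !phi_parallel, wave_curve_periodic.
      + intros u; unfold b; now rewrite !phi_parallel, wave_curve_periodic.
    - apply RInt2_bound; auto.
      intros u.
      rewrite (RInt_ext (P u)
        (trig_pair (a u) (b u) (IZR n) (IZR n1 * u + psi))).
      2:{ intros v _; unfold P, ph, trig_pair; rewrite E.
          replace (IZR n2 * v + (IZR n1 * u + psi)) with (IZR n1 * u + IZR n2 * v + psi) by ring.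
          reflexivity. }
      apply RInt_trig_pair_decay; auto.
      + eapply diff_chain_ext;
          [| | apply (Hch (cos u, - (PI / 2)) (sin u, - (PI / 2)) (1, 0) 0 0 0)].
        * intros v; unfold a; now rewrite phi_meridian.
        * intros v; unfold b; now rewrite phi_meridian.
        * exact Hh.
        * apply Htrig, COS_bound.
        * apply Htrig, SIN_bound.
        * apply Htrig; simpl; lra.
        * intros t; rewrite <- phi_meridian; apply S2_phi.
      + intros v; unfold a; now rewrite !phi_meridian, wave_curve_periodic.
      + intros v; unfold b; now rewrite !phi_meridian, wave_curve_periodic. }
  assert (Hm : Rabs (IZR n) ^ k <> 0).
  { apply pow_nonzero, Rabs_no_R0; now apply not_0_IZR. }
  assert (HP2 : 0 < (2 * PI) ^ 2) by (apply pow_lt; lra).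
  set (Ire := RInt (fun x1 => RInt (re x1) 0 (2 * PI)) 0 (2 * PI)) in *.
  set (Iim := RInt (fun x1 => RInt (im x1) 0 (2 * PI)) 0 (2 * PI)) in *.
  replace (cos psi * (/ (2 * PI) ^ 2 * Ire) + sin psi * (/ (2 * PI) ^ 2 * Iim))
    with (/ (2 * PI) ^ 2 * (cos psi * Ire + sin psi * Iim)) by ring.
  rewrite EP.
  (* The normalization (2 PI)^(-2), the outer length 2 PI and the PI of the half shift leave the
     factor 1/2. *)
  replace (/ 2 * (K / Rabs (IZR n) ^ k))
    with (/ (2 * PI) ^ 2 * (2 * PI * (PI * K / Rabs (IZR n) ^ k))) by (field; split; lra || auto).
  apply Rmult_le_compat_l; [left; now apply Rinv_0_lt_compat |].
  eapply Rle_trans; [apply Rle_abs | exact HB].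
Qed.

Lemma znorm_le_sqrt2_max (n1 n2 : Z) :
  (n1 <> 0%Z \/ n2 <> 0%Z) ->
  exists n, n <> 0%Z /\ (n = n1 \/ n = n2) /\
    0 < znorm n1 n2 <= sqrt 2 * Rabs (IZR n).
Proof.
  intros Hn.
  assert (Hpos : 0 < IZR n1 ^ 2 + IZR n2 ^ 2).
  { assert (Q1 := pow2_ge_0 (IZR n1)); assert (Q2 := pow2_ge_0 (IZR n2)).
    destruct Hn as [Hn | Hn]; apply not_0_IZR in Hn; apply pow2_gt_0 in Hn; lra. }
  assert (Hmax : forall m, IZR n1 ^ 2 + IZR n2 ^ 2 <= 2 * IZR m ^ 2 ->
            m <> 0%Z /\ 0 < znorm n1 n2 <= sqrt 2 * Rabs (IZR m)).
  { intros m Hm; split; [intros ->; simpl in Hm; lra |].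
    split; [now apply sqrt_lt_R0 |].
    rewrite <- sqrt_Rsqr_abs, <- sqrt_mult_alt by lra.
    apply sqrt_le_1_alt; unfold Rsqr; simpl in *; lra. }
  destruct (Rle_dec (IZR n1 ^ 2) (IZR n2 ^ 2)) as [H | H].
  - exists n2; destruct (Hmax n2); [lra | auto].
  - exists n1; destruct (Hmax n1); [lra | auto].
Qed.

(** Raising r <= sqrt 2 m to the power k + alpha produces 2^((k + alpha) / 2), and the factor 1/2
    lowers this exponent by 1. *)
Lemma decay_rate_le (k : nat) (alpha m r : R) :
  0 < alpha -> 0 < m -> 0 < r <= sqrt 2 * m ->
  / 2 * (Rpower (PI / m) alpha / m ^ k)
  <= Rpower 2 ((INR k + alpha) / 2 - 1) * Rpower PI alpha / Rpower r (INR k + alpha).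
Proof.
  intros Ha Hm Hr.
  assert (HPI := PI_RGT_0).
  set (s := INR k + alpha).
  assert (Hs : 0 <= s) by (unfold s; generalize (pos_INR k); lra).
  assert (Hp : forall x y, 0 < Rpower x y) by (intros; apply exp_pos).
  assert (E1 : Rpower (PI / m) alpha * Rpower m alpha = Rpower PI alpha).
  { rewrite Rpower_mult_distr; [f_equal; field; lra | apply Rdiv_lt_0_compat; lra | lra]. }
  assert (E2 : Rpower 2 (s / 2 - 1) = Rpower 2 (s / 2) * / 2).
  { unfold Rminus; rewrite Rpower_plus, Rpower_Ropp, Rpower_1 by lra; reflexivity. }
  assert (E3 : Rpower r s <= Rpower 2 (s / 2) * (m ^ k * Rpower m alpha)).
  { rewrite <- Rpower_pow, <- Rpower_plus by auto; fold s.
    replace (s / 2) with (/ 2 * s) by field.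
    rewrite <- Rpower_mult, Rpower_sqrt by lra.
    rewrite Rpower_mult_distr by (try apply sqrt_lt_R0; lra).
    apply Rle_Rpower_l; auto. }
  rewrite E2, <- E1.
  assert (Hmk : 0 < m ^ k) by (now apply pow_lt).
  assert (H1 := Hp m alpha); assert (H2 := Hp r s); assert (H3 := Hp (PI / m) alpha).
  set (A := Rpower (PI / m) alpha) in *; set (B := Rpower m alpha) in *.
  set (D := Rpower r s) in *; set (T := Rpower 2 (s / 2)) in *; set (M := m ^ k) in *.
  apply Rmult_le_reg_r with (2 * M * D); [repeat apply Rmult_lt_0_compat; lra |].
  replace (/ 2 * (A / M) * (2 * M * D)) with (A * D) by (field; lra).
  replace (T * / 2 * (A * B) / D * (2 * M * D)) with (A * (T * (M * B))) by (field; lra).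
  apply Rmult_le_compat_l; lra.
Qed.

Lemma fourier_coef_le_ext_value (k : nat) (alpha N : R) (f : P3 -> C) (n1 n2 : Z) :
  0 < alpha -> 0 <= N -> (n1 <> 0%Z \/ n2 <> 0%Z) ->
  (forall n, n <> 0%Z -> n = n1 \/ n = n2 ->
    Cmod (fourier_coef (dfs f) n1 n2)
    <= / 2 * (INR (fact (k + 3)) * N * Rpower (Rabs (PI / IZR n)) alpha / Rabs (IZR n) ^ k)) ->
  Cmod (fourier_coef (dfs f) n1 n2)
  <= Rpower 2 ((INR k + alpha) / 2 - 1) * Rpower PI alpha
     * INR (fact (k + 3)) / Rpower (znorm n1 n2) (INR k + alpha) * N.
Proof.
  intros Ha HN Hn H.
  destruct (znorm_le_sqrt2_max n1 n2 Hn) as (n & Hn0 & Hn12 & Hz).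
  eapply Rle_trans; [apply (H n Hn0 Hn12) |].
  assert (Hm : 0 < Rabs (IZR n)) by (now apply Rabs_pos_lt, not_0_IZR).
  assert (E : Rabs (PI / IZR n) = PI / Rabs (IZR n)).
  { unfold Rdiv; rewrite Rabs_mult, Rabs_inv, (Rabs_pos_eq PI); auto.
    generalize PI_RGT_0; lra. }
  rewrite E.
  assert (D := decay_rate_le k alpha _ _ Ha Hm Hz).
  assert (HF : 0 <= INR (fact (k + 3)) * N) by (apply Rmult_le_pos; auto using pos_INR).
  assert (D' := Rmult_le_compat_l _ _ _ HF D).
  eapply Rle_trans; [| eapply Rle_trans; [exact D' |]]; right; unfold Rdiv; ring.
Qed.

Theorem theorem5p7 (k : nat) (alpha : R) (f : P3 -> C) :
  0 < alpha -> alpha <= 1 -> inSH k alpha f ->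
  forall n1 n2 : Z, (n1 <> 0%Z \/ n2 <> 0%Z) ->
    Cmod (fourier_coef (dfs f) n1 n2) <=
      Rpower 2 ((INR k + alpha) / 2 - 1) * Rpower PI alpha
      * INR (fact (k + 3)) / Rpower (znorm n1 n2) (INR k + alpha)
      * normSH k alpha f.
Proof.
  intros Ha Ha1 Hin n1 n2 Hn.
  set (c := Rpower 2 ((INR k + alpha) / 2 - 1) * Rpower PI alpha
            * INR (fact (k + 3)) / Rpower (znorm n1 n2) (INR k + alpha)).
  assert (Hc : 0 < c).
  { unfold c, Rdiv; repeat apply Rmult_lt_0_compat; try apply exp_pos.
    - apply INR_fact_lt_0.
    - apply Rinv_0_lt_compat, exp_pos. }
  (* The constant [c] is independent of the extension, so dividing by it exhibits a lower bound of
     all extension values. An admissible extension must exist, since [real] would send an infinite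
     infimum to 0. *)
  assert (Hglb : forall E : R -> Prop, (exists v, E v) ->
    (forall v, E v -> Cmod (fourier_coef (dfs f) n1 n2) <= c * v) ->
    Cmod (fourier_coef (dfs f) n1 n2) <= c * real (Glb_Rbar E)).
  { intros E [v Hv] HE.
    assert (Hdiv : Cmod (fourier_coef (dfs f) n1 n2) / c <= real (Glb_Rbar E)).
    { apply le_real_Glb_Rbar with v; auto; intros w Hw.
      apply Rmult_le_reg_l with c; auto.
      replace (c * (Cmod (fourier_coef (dfs f) n1 n2) / c))
        with (Cmod (fourier_coef (dfs f) n1 n2)) by (field; lra); auto. }
    apply Rmult_le_compat_l with (r := c) in Hdiv; [| lra].
    replace (c * (Cmod (fourier_coef (dfs f) n1 n2) / c))
      with (Cmod (fourier_coef (dfs f) n1 n2)) in Hdiv by (field; lra); exact Hdiv. }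
  assert (Hpole : S2 (mkP3 0 0 1)) by (unfold S2; simpl; ring).
  assert (Hnn : forall U K a g, (forall x, S2 x -> U x) -> Ck U K g -> 0 <= ext_value K a g).
  { intros U K a g HS Hg; eapply Rle_trans; [apply Cmod_ge_0 |].
    apply (ext_value_ge_sup U K a g (0, 0, 0)%nat (mkP3 0 0 1)); auto; simpl; lia. }
  unfold normSH, inSH in *; destruct (Rlt_dec alpha 1) as [Hlt | Hge]; apply Hglb; auto.
  - intros v (U & g & HU & HS & Hg & Hfg & ->).
    apply fourier_coef_le_ext_value; auto.
    { apply (Hnn U); auto; apply Hg. }
    apply (fourier_coef_dfs_bound U k alpha (ext_value k alpha g) f g); auto.
    + intros b Hb; apply Hg; lia.
    + intros; apply diff_chain_holder with U; auto.
  (* By convention the norm is now that of order k + 1 without a Hölder term, while the chain keeps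
     length [k]. *)
  - assert (E : alpha = 1) by lra; subst alpha.
    intros v (U & g & HU & HS & [Hg _] & Hfg & ->).
    apply fourier_coef_le_ext_value; auto.
    { apply (Hnn U); auto. }
    apply (fourier_coef_dfs_bound U k 1 (ext_value (S k) 0 g) f g); auto.
    + intros b Hb; apply Hg; lia.
    + intros; apply diff_chain_smooth with U; auto.
Qed.
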